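(* Let $(P_t)_{t\ge0}$, with generator $(L,\mathrm{Dom}(L))$, be the transition semigroup on $L^2(\mathcal S,\mu)$ of a reversible Markov process with invariant probability measure $\mu$, and let $(\hat P_t)_{t\ge0}$, with generator $(\hat L,\mathrm{Dom}(\hat L))$, be the transition semigroup on $L^2(\mathcal S\times\mathcal V,\hat\mu)$ of an arbitrary second-order lift of $(P_t)_{t\ge0}$. Let $T,\nu\in(0,\infty)$. If $(\hat P_t)_{t\ge0}$ is $T$-delayed exponentially contractive with rate $\nu$ or exponentially contractive in $2T$-average with rate $\nu$, then $$\frac1\nu+T\ge\frac{1}{\sqrt{2\,\mathrm{gap}(L)}}.$$ In particular, $$t_{\mathrm{rel}}(\hat P)\ge\frac{1}{2\sqrt2}\sqrt{t_{\mathrm{rel}}(P)}.$$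
   Context: $\mathcal S$ and $\mathcal V$ are measurable state spaces, $\mu$ is a probability measure on $\mathcal S$, $\kappa$ is a Markov kernel from $\mathcal S$ to $\mathcal V$, $\hat\mu(dx\,dv)=\mu(dx)\kappa(x,dv)$ is a probability measure on $\hat{\mathcal S}=\mathcal S\times\mathcal V$, and $\pi(x,v)=x$. The semigroups $(P_t)$ and $(\hat P_t)$ are Markov semigroups (strongly continuous contraction semigroups on $L^2(\mu)$ and $L^2(\hat\mu)$) with invariant measures $\mu$ and $\hat\mu$; $(P_t)$ is reversible, i.e. each $P_t$ is self-adjoint on $L^2(\mu)$. For $f,g\in\mathrm{Dom}(L)$ put $\mathcal E(f,g)=-\int_{\mathcal S}fLg\,d\mu$. Second-order lift: $(\hat P_t)_{t\ge0}$ is a second-order lift of $(P_t)_{t\ge0}$ if $f\circ\pi\in\mathrm{Dom}(\hat L)$ for every $f\in\mathrm{Dom}(L)$, and for all $f,g\in\mathrm{Dom}(L)$ $$\int_{\hat{\mathcal S}}\hat L(f\circ\pi)\,(g\circ\pi)\,d\hat\mu=0,\qquad \frac12\int_{\hat{\mathcal S}}\hat L(f\circ\pi)\,\hat L(g\circ\pi)\,d\hat\mu=\mathcal E(f,g).$$ For a Markov semigroup $(Q_t)_{t\ge 0}$ on $L^2(\rho)$ with invariant probability measure $\rho$, let $L^2_0(\rho)=\{f\in L^2(\rho):\int f\,d\rho=0\}$. For $S,\nu\in(0,\infty)$, $(Q_t)$ is $S$-delayed exponentially contractive with rate $\nu$ if $\|Q_tf\|_{L^2(\rho)}\le e^{-\nu(t-S)}\|f\|_{L^2(\rho)}$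 for all $f\in L_0^2(\rho)$, $t\ge0$; it is exponentially contractive in $S$-average with rate $\nu$ if $\frac1S\int_t^{t+S}\|Q_sf\|_{L^2(\rho)}ds\le e^{-\nu t}\|f\|_{L^2(\rho)}$ for all $f\in L_0^2(\rho)$, $t\ge0$. Its relaxation time is $t_{\mathrm{rel}}(Q)=\inf\{t\ge0:\|Q_tf\|_{L^2(\rho)}\le e^{-1}\|f\|_{L^2(\rho)}\text{ for all }f\in L_0^2(\rho)\}$. The spectral gap is $\mathrm{gap}(L)=\inf\{\mathrm{Re}(\alpha):\alpha\in\mathrm{spec}(-L|_{L^2_0(\mu)})\}$. Conventions: $\inf\emptyset=+\infty$, $1/\infty=0$, $1/0=+\infty$. *)

(* Defs.v *)
From HB Require Import structures.
From mathcomp Require Import all_boot all_order all_algebra.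
From mathcomp Require Import all_classical all_reals all_analysis.
From mathcomp Require Import complex.
Set Implicit Arguments.
Unset Strict Implicit.
Unset Printing Implicit Defensive.
Import Order.TTheory GRing.Theory Num.Theory.
Import numFieldNormedType.Exports.
Local Open Scope classical_set_scope.
Local Open Scope ring_scope.

(* Elements of L^2(mu) are represented by square-integrable functions, and
   identities between them hold mu-almost everywhere. An operator on L^2(mu) is
   a map on functions, of which only the values on L2 mu, up to null sets, are
   relevant; a semigroup is indexed by all of R, but only times t >= 0 are
   relevant. *)

Section SemigroupsOnL2.
Context (d : measure_display) (T : measurableType d) (R : realType).
Implicit Types (mu : probability T R) (f g : T -> R).
Implicit Types (Q : R -> (T -> R) -> (T -> R)).

Definition L2 mu : set (T -> R) := [set f | f \in Lfun mu 2%:E].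

Definition L20 mu : set (T -> R) :=
  [set f | L2 mu f /\ \int[mu]_x f x = 0].

Definition L2norm mu f : \bar R := ('N[mu]_2%:E[EFin \o f])%E.

Record contraction_semigroup mu Q : Prop := {
  semigroup_ae_eq : forall t : R, 0 <= t -> forall f g, L2 mu f -> L2 mu g ->
    f = g %[ae mu] -> Q t f = Q t g %[ae mu] ;
  semigroup_linear : forall t : R, 0 <= t -> forall a f g, L2 mu f -> L2 mu g ->
    Q t (fun x => a * f x + g x)
      = (fun x => a * Q t f x + Q t g x) %[ae mu] ;
  semigroup_L2 : forall t : R, 0 <= t -> forall f, L2 mu f -> L2 mu (Q t f) ;
  semigroup_contraction : forall t : R, 0 <= t -> forall f, L2 mu f ->
    (L2norm mu (Q t f) <= L2norm mu f)%E ;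
  semigroup0 : forall f, L2 mu f -> Q 0 f = f %[ae mu] ;
  semigroupD : forall s t : R, 0 <= s -> 0 <= t -> forall f, L2 mu f ->
    Q (s + t) f = Q s (Q t f) %[ae mu] ;
  semigroup_continuous : forall f, L2 mu f ->
    L2norm mu (fun x => Q t f x - f x) @[t --> (0 : R)^'+] --> 0%E }.

Definition invariant_measure (k : R.-pker T ~> T) mu : Prop :=
  forall A, measurable A -> (\int[mu]_x k x A = mu A)%E.

(* The integral \int[p t x]_y f y is defined for mu-almost every x when f is in
   L^2(mu), by invariance. *)
Definition markov_semigroup mu Q : Prop :=
  contraction_semigroup mu Q /\
  exists p : R -> R.-pker T ~> T, forall t : R, 0 <= t ->
    invariant_measure (p t) mu /\
    forall f, L2 mu f -> Q t f = (fun x => \int[p t x]_y f y) %[ae mu].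

Definition reversible mu Q : Prop :=
  forall t : R, 0 <= t -> forall f g, L2 mu f -> L2 mu g ->
    \int[mu]_x (Q t f x * g x) = \int[mu]_x (f x * Q t g x).

Definition is_generator mu Q f g : Prop :=
  [/\ L2 mu f, L2 mu g &
    L2norm mu (fun x => t^-1 * (Q t f x - f x) - g x) @[t --> (0 : R)^'+] --> 0%E].

Definition Dom mu Q : set (T -> R) :=
  [set f | exists g, is_generator mu Q f g].

(* A representative of the (mu-a.e. unique) image of f under the generator. *)
Definition gen mu Q f : T -> R :=
  xget (cst 0) [set g | is_generator mu Q f g].

Definition dirichlet_form mu Q f g : R :=
  - \int[mu]_x (f x * gen mu Q g x).

Definition delayed_contractive mu Q (S nu : R) : Prop :=
  forall f, L20 mu f -> forall t : R, 0 <= t ->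
    (L2norm mu (Q t f) <= (expR (- nu * (t - S)))%:E * L2norm mu f)%E.

Definition average_contractive mu Q (S nu : R) : Prop :=
  forall f, L20 mu f -> forall t : R, 0 <= t ->
    ((S^-1)%:E * \int[lebesgue_measure]_(s in `[t, (t + S)%R]) L2norm mu (Q s f)
      <= (expR (- nu * t))%:E * L2norm mu f)%E.

Definition relaxation_time mu Q : \bar R :=
  ereal_inf [set t%:E | t in [set t : R | 0 <= t /\
    forall f, L20 mu f ->
      (L2norm mu (Q t f) <= (expR (-1))%:E * L2norm mu f)%E]].

(* L^2(mu) is real: the spectrum is that of the complexified operator. *)
Definition complexification (E : set (T -> R)) : set (T -> R[i]) :=
  [set F | E (fun x => complex.Re (F x)) /\ E (fun x => complex.Im (F x))].

Definition genC mu Q (F : T -> R[i]) (x : T) : R[i] :=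
  (gen mu Q (fun y => complex.Re (F y)) x
     +i* gen mu Q (fun y => complex.Im (F y)) x)%C.

Definition L2normC mu (F : T -> R[i]) : \bar R :=
  L2norm mu (fun x => Normc.normc (F x)).

Definition L20C mu := complexification (L20 mu).

Definition Dom0C mu Q := complexification (Dom mu Q `&` L20 mu).

Definition shifted_gen mu Q (alpha : R[i]) (F : T -> R[i]) (x : T) : R[i] :=
  - genC mu Q F x - alpha * F x.

(* Resolvent set of the restriction of -L to L^2_0(mu), for L the generator of
   Q: -L - alpha is injective, surjective, and its inverse is bounded. *)
Definition resolvent_set mu Q : set R[i] :=
  [set alpha |
    [/\ forall F G, Dom0C mu Q F -> Dom0C mu Q G ->
          shifted_gen mu Q alpha F = shifted_gen mu Q alpha G %[ae mu] ->
          F = G %[ae mu],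
        forall H, L20C mu H -> exists2 F, Dom0C mu Q F &
          shifted_gen mu Q alpha F = H %[ae mu] &
        exists C : R, forall F, Dom0C mu Q F ->
          (L2normC mu F <= C%:E * L2normC mu (shifted_gen mu Q alpha F))%E]].

Definition spectrum mu Q : set R[i] := ~` resolvent_set mu Q.

Definition gap mu Q : \bar R :=
  ereal_inf [set (complex.Re alpha)%:E | alpha in spectrum mu Q].

End SemigroupsOnL2.

Section Lifts.
Context (d d' : measure_display) (X : measurableType d) (V : measurableType d').
Context (R : realType).

Definition disintegrates (muh : probability (X * V)%type R)
    (mu : probability X R) (kappa : R.-pker X ~> V) : Prop :=
  forall A, measurable A -> muh A = (\int[mu]_x kappa x (xsection A x))%E.

Definition second_order_lift
    (mu : probability X R) (P : R -> (X -> R) -> (X -> R))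
    (muh : probability (X * V)%type R)
    (Ph : R -> (X * V -> R) -> (X * V -> R)) : Prop :=
  (forall f, Dom mu P f -> Dom muh Ph (f \o fst)) /\
  (forall f g, Dom mu P f -> Dom mu P g ->
    \int[muh]_z (gen muh Ph (f \o fst) z * (g \o fst) z) = 0 /\
    2^-1 * \int[muh]_z (gen muh Ph (f \o fst) z * gen muh Ph (g \o fst) z)
      = dirichlet_form mu P f g).

End Lifts.

(* Main.v *)
Require Import Defs.
From mathcomp Require Import all_boot all_order all_algebra.
From mathcomp Require Import all_classical all_reals all_analysis.
From mathcomp Require Import measurable_realfun.
From mathcomp Require Import ring lra.
From mathcomp Require Import complex.
Import Order.TTheory GRing.Theory Num.Theory.
Import numFieldNormedType.Exports.
Local Open Scope classical_set_scope.
Local Open Scope ring_scope.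
Set Implicit Arguments.
Unset Strict Implicit.
Unset Printing Implicit Defensive.

(* Let Lh be the generator of the lift. Decay of the lifted semigroup bounds
   the inverse of Lh on mean-zero functions: |F| <= int_0^oo |Ph_t Lh F| dt
   <= K |Lh F| with K = 1/nu + T. For F = f o pi the lift identities give
   |Lh F|^2 = 2 E(f, f), hence the Poincare inequality
   |f|^2 <= 2 K^2 E(f, f). The latter yields |P_t f| <= exp(- c t) |f| on
   mean-zero functions, with c = 1 / (2 K^2). Then for Re alpha < c the integral
   int_0^oo exp(alpha t) P_t dt inverts - L - alpha, so gap(L) >= c, and
   t_rel(P) <= 1/c. For the second bound, a time t with |Ph_t| <= 1/e makes Ph
   t-delayed contractive with rate 1/t, whence K = 2 t and t_rel(P) <= 8 t^2.
   All time integrals are replaced by Riemann sums, so that only finite sums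
   and limits in L^2 are needed. *)

(** The resolvent is solved twice, and this breaks an apparent circle. The Poincare inequality
    speaks only of the domain of the generator, whereas decay is wanted for all mean-zero functions,
    so density of the domain must come first. It is obtained from the spectral parameter -1, where
    contraction alone makes exp (- t) P_t decay; parameters with real part up to c become available
    afterwards. For these, the time integral supplies surjectivity only: injectivity and the bound
    on the inverse come from coercivity of - L - alpha.

    The constant K is the integral over all times of a bound on the operator norm, namely 1 up to
    time T and exp (- nu (t - T)) later. A window of length 2 T leads to the same K because the
    weight 1 - s / (2 T) has integral T over it.

    The spectrum is complex while the function space is real, so complex functions are handled as
    pairs of real ones. Elements of L^2 are functions and not classes; equality in L^2 is therefore
    carried as the vanishing of [nrm] on a difference, and returns to almost everywhere equality
    only where a definition asks for it. *)

(** * Inner product and seminorm on square-integrable functions *)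

Section L2.
Context (d : measure_display) (T : measurableType d) (R : realType).
Variable mu : probability T R.
Implicit Types (f g h : T -> R) (a b : R).

Definition ip f g : R := \int[mu]_x (f x * g x).
Definition nrm f : R := Num.sqrt (ip f f).

Lemma L2_measurable f : L2 mu f -> measurable_fun setT f.
Proof. by rewrite /L2/= inE => /andP[]; rewrite inE. Qed.

Lemma L2_lin a f g : L2 mu f -> L2 mu g -> L2 mu (a *: f + g).
Proof.
move=> Lf Lg; have h1 : (1 <= 2%:E :> \bar R)%E by rewrite lee_fin ler1n.
by have [_ /(_ a f g Lf Lg)] := Lfun_submod_closed mu h1.
Qed.

Lemma L2_cst a : L2 mu (cst a).
Proof. exact: Lfun_cst. Qed.

Lemma L2_0 : L2 mu 0. Proof. exact: L2_cst. Qed.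

Lemma L2_Z a f : L2 mu f -> L2 mu (a *: f).
Proof. by move=> Lf; rewrite -[_ *: _]addr0; apply: L2_lin => //; exact: L2_0. Qed.

Lemma L2_D f g : L2 mu f -> L2 mu g -> L2 mu (f + g).
Proof. by move=> Lf Lg; rewrite -[f]scale1r; apply: L2_lin. Qed.

Lemma L2_B f g : L2 mu f -> L2 mu g -> L2 mu (f - g).
Proof. by move=> Lf Lg; rewrite addrC -scaleN1r; apply: L2_lin. Qed.

Lemma L2_mul_integrable f g : L2 mu f -> L2 mu g ->
  mu.-integrable setT (EFin \o (fun x => f x * g x)).
Proof. by move=> Lf Lg; apply/Lfun1_integrable; exact: Lfun2_mul_Lfun1. Qed.

Lemma ipC f g : ip f g = ip g f.
Proof. by apply: eq_Rintegral => x _; rewrite mulrC. Qed.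

Lemma ip_linl a f g h : L2 mu f -> L2 mu g -> L2 mu h ->
  ip (a *: f + g) h = a * ip f h + ip g h.
Proof.
move=> Lf Lg Lh; rewrite /ip.
rewrite -RintegralZl//; last exact: L2_mul_integrable.
rewrite -RintegralD//.
- by apply: eq_Rintegral => x _; rewrite /= mulrDl mulrA.
- have := L2_mul_integrable (L2_Z a Lf) Lh.
  by congr (_.-integrable _ _); apply/funext => x /=; rewrite mulrA.
- exact: L2_mul_integrable.
Qed.

Lemma ip_Dl f g h : L2 mu f -> L2 mu g -> L2 mu h ->
  ip (f + g) h = ip f h + ip g h.
Proof. by move=> ? ? ?; rewrite -[f]scale1r ip_linl// mul1r scale1r. Qed.

Lemma ip_Zl a f h : L2 mu f -> L2 mu h -> ip (a *: f) h = a * ip f h.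
Proof.
move=> Lf Lh; rewrite -[_ *: _]addr0 ip_linl//; last exact: L2_0.
by rewrite (_ : ip 0 h = 0) ?addr0// /ip; under eq_Rintegral do rewrite mul0r;
  rewrite Rintegral_cst// mul0r.
Qed.

Lemma ip_Bl f g h : L2 mu f -> L2 mu g -> L2 mu h ->
  ip (f - g) h = ip f h - ip g h.
Proof. by move=> ? ? ?; rewrite addrC -scaleN1r ip_linl// mulN1r addrC. Qed.

Lemma ip_Dr f g h : L2 mu f -> L2 mu g -> L2 mu h ->
  ip h (f + g) = ip h f + ip h g.
Proof. by move=> *; rewrite ipC ip_Dl// !(ipC h). Qed.

Lemma ip_Zr a f h : L2 mu f -> L2 mu h -> ip h (a *: f) = a * ip h f.
Proof. by move=> *; rewrite ipC ip_Zl// (ipC h). Qed.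

Lemma ip_Br f g h : L2 mu f -> L2 mu g -> L2 mu h ->
  ip h (f - g) = ip h f - ip h g.
Proof. by move=> *; rewrite ipC ip_Bl// !(ipC h). Qed.

Lemma ip_ge0 f : 0 <= ip f f.
Proof. by apply: Rintegral_ge0 => x _; rewrite -expr2 sqr_ge0. Qed.

Lemma nrm_ge0 f : 0 <= nrm f. Proof. exact: sqrtr_ge0. Qed.

Lemma nrm2 f : nrm f ^+ 2 = ip f f.
Proof. by rewrite sqr_sqrtr// ip_ge0. Qed.

Lemma nrmZ a f : L2 mu f -> nrm (a *: f) = `|a| * nrm f.
Proof.
move=> Lf; have La := L2_Z a Lf; rewrite /nrm ip_Zl// ip_Zr// mulrA -expr2.
by rewrite sqrtrM ?sqr_ge0// sqrtr_sqr.
Qed.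

Lemma ip_CS f g : L2 mu f -> L2 mu g -> `|ip f g| <= nrm f * nrm g.
Proof.
move=> Lf Lg; rewrite -sqrtrM ?ip_ge0// -sqrtr_sqr ler_wsqrtr//.
have q (t : R) : 0 <= t ^+ 2 * ip f f + 2 * t * ip f g + ip g g.
  have := ip_ge0 (t *: f + g).
  rewrite ip_linl//; last exact: L2_lin.
  rewrite (ipC f) (ipC g) !ip_linl// (ipC g f); lra.
have [f0|f0] := eqVneq (ip f f) 0; last first.
  have fp : 0 < ip f f by rewrite lt0r f0 ip_ge0.
  have := q (- ip f g / ip f f).
  rewrite -(pmulr_rge0 _ fp).
  have -> : ip f f * ((- ip f g / ip f f) ^+ 2 * ip f f +
     2 * (- ip f g / ip f f) * ip f g + ip g g) =
    ip f f * ip g g - ip f g ^+ 2 by field.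
  by rewrite subr_ge0.
have [g0|g0] := eqVneq (ip f g) 0.
  by rewrite g0 expr0n/= mulr_ge0// ip_ge0.
(* With [ip f f = 0] the quadratic is affine in t, and this t gives it the value -1, a
   contradiction. *)
have := q (- (1 + ip g g) / (2 * ip f g)); rewrite f0 mulr0 add0r.
have -> : 2 * (- (1 + ip g g) / (2 * ip f g)) * ip f g = - (1 + ip g g).
  by field.
lra.
Qed.

Lemma nrm_triangle f g : L2 mu f -> L2 mu g -> nrm (f + g) <= nrm f + nrm g.
Proof.
move=> Lf Lg; rewrite -(@ler_pXn2r _ 2)// ?nnegrE ?addr_ge0 ?nrm_ge0//.
have Lfg := L2_D Lf Lg.
rewrite sqrrD !nrm2 ip_Dl// !ip_Dr// (ipC g f).
have /ler_normlP[_] := ip_CS Lf Lg; lra.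
Qed.

Lemma nrmN f : nrm (- f) = nrm f.
Proof.
by rewrite /nrm /ip; congr (Num.sqrt _); apply: eq_Rintegral => x _;
  rewrite mulrNN.
Qed.

Lemma nrm_distC f g : nrm (f - g) = nrm (g - f).
Proof. by rewrite -nrmN opprB. Qed.

Lemma nrm0 : nrm 0 = 0.
Proof. by rewrite -(scale0r 0) nrmZ ?normr0 ?mul0r//; exact: L2_0. Qed.

Lemma ae_eq_ip f f' g g' : L2 mu f -> L2 mu f' -> L2 mu g -> L2 mu g' ->
  f = f' %[ae mu] -> g = g' %[ae mu] -> ip f g = ip f' g'.
Proof.
move=> Lf Lf' Lg Lg' ff' gg'; congr fine; apply: ae_eq_integral => //.
- by apply/measurable_EFinP/measurable_funM; exact: L2_measurable.
- by apply/measurable_EFinP/measurable_funM; exact: L2_measurable.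
- by apply: filterS2 ff' gg' => x /= -> // ->.
Qed.

Lemma ae_eq_nrm f f' : L2 mu f -> L2 mu f' -> f = f' %[ae mu] ->
  nrm f = nrm f'.
Proof. by move=> Lf Lf' ff'; rewrite /nrm (ae_eq_ip Lf Lf' Lf Lf'). Qed.

Lemma L2normE f : L2 mu f -> L2norm mu f = (nrm f)%:E.
Proof.
move=> Lf; rewrite /L2norm unlock /nrm -[RHS]/(sqrte (ip f f)%:E).
rewrite -poweR12_sqrt ?lee_fin ?ip_ge0//; congr (_ `^ _)%E.
rewrite /ip /Rintegral fineK; last first.
  by apply: integrable_fin_num => //; exact: L2_mul_integrable.
by apply: eq_integral => x _ /=; rewrite powR_mulrn// real_normK ?num_real.
Qed.

Lemma nrm_eq0 f : L2 mu f -> nrm f = 0 <-> f = 0 %[ae mu].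
Proof.
move=> Lf; split => f0; last by rewrite (ae_eq_nrm Lf L2_0 f0) nrm0.
have := L2normE Lf; rewrite f0 => /Lnorm_eq0_eq0.
have /measurable_EFinP mf := L2_measurable Lf.
by move=> /(_ mf) /(_ ltac:(by rewrite lte_fin)); apply: filterS => x /(_ I) [].
Qed.

Lemma nrm_ae_eq f g : L2 mu f -> L2 mu g -> nrm (f - g) = 0 ->
  f = g %[ae mu].
Proof.
move=> Lf Lg /(nrm_eq0 (L2_B Lf Lg)); apply: filterS => x /= /[apply].
by move/eqP; rewrite subr_eq0 => /eqP.
Qed.

Lemma ae_eq_nrmB f g : L2 mu f -> L2 mu g -> f = g %[ae mu] ->
  nrm (f - g) = 0.
Proof.
move=> Lf Lg fg; apply/nrm_eq0; first exact: L2_B.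
by apply: filterS fg => x /= /[apply] fgx; rewrite -[LHS]/(f x - g x) fgx subrr.
Qed.

Lemma L2_mean_ip f : \int[mu]_x f x = ip f (cst 1).
Proof. by apply: eq_Rintegral => x _; rewrite mulr1. Qed.

Lemma nrm_cst1 : nrm (cst 1) = 1.
Proof.
rewrite /nrm /ip; under eq_Rintegral do rewrite mulr1.
rewrite Rintegral_cst// mul1r.
have -> : fine (mu setT) = 1 by rewrite (@probability_setT _ _ _ mu).
exact: sqrtr1.
Qed.

Lemma L20_lin a f g : L20 mu f -> L20 mu g -> L20 mu (a *: f + g).
Proof.
move=> [Lf f0] [Lg g0]; split; first exact: L2_lin.
rewrite [LHS](L2_mean_ip (a *: f + g)) ip_linl//; last exact: L2_cst.
by rewrite -!L2_mean_ip f0 g0 mulr0 addr0.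
Qed.

Lemma L20_0 : L20 mu 0.
Proof. by split; [exact: L2_0|rewrite Rintegral_cst// mul0r]. Qed.

Lemma L20_Z a f : L20 mu f -> L20 mu (a *: f).
Proof.
by move=> Lf; rewrite -[_ *: _]addr0; apply: L20_lin => //; exact: L20_0.
Qed.

Lemma L20_D f g : L20 mu f -> L20 mu g -> L20 mu (f + g).
Proof. by move=> Lf Lg; rewrite -[f]scale1r; apply: L20_lin. Qed.

Lemma L20_B f g : L20 mu f -> L20 mu g -> L20 mu (f - g).
Proof. by move=> Lf Lg; rewrite addrC -scaleN1r; apply: L20_lin. Qed.

End L2.

(** * Completeness of L^2 and of its mean-zero subspace *)

Section L2_complete.
Context (d : measure_display) (T : measurableType d) (R : realType).
Variable mu : probability T R.
Implicit Types (f g h : T -> R) (a b : R).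
Local Notation ip := (ip mu).
Local Notation nrm := (nrm mu).

(** Hoelder against the constant 1, which has norm 1 because [mu] is a probability. It turns
    summability in L^2 into summability in L^1, hence into almost everywhere convergence. *)
Lemma integral_normr_le_nrm f : L2 mu f ->
  (\int[mu]_x `|(f x)%:E| <= (nrm f)%:E)%E.
Proof.
move=> Lf; have mf := L2_measurable Lf.
have := @hoelder _ _ _ mu f (cst 1) 2 2 mf (measurable_cst _).
rewrite -(Lnorm1 mu (EFin \o f)) => H.
have -> : ('N[mu]_1[EFin \o f] = 'N[mu]_1[EFin \o (f \* cst 1)%R])%E.
  by apply: eq_Lnorm => x /=; rewrite mulr1.
apply: (le_trans (H _ _ _)) => //; first by rewrite [RHS]splitr !div1r.
by rewrite -!/(L2norm _ _) !L2normE ?nrm_cst1 ?mule1//; exact: L2_cst.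
Qed.

(** Membership in L^2 is reduced to one integral of a nonnegative function, to which Fatou and
    changes of measure apply before any integrability is known. *)
Lemma L2_of_integral_sqr f (C : R) : measurable_fun setT f -> 0 <= C ->
  (\int[mu]_x (f x ^+ 2)%:E <= (C ^+ 2)%:E)%E -> L2 mu f /\ nrm f <= C.
Proof.
move=> mf C0 fC.
have NC : (L2norm mu f <= C%:E)%E.
  rewrite /L2norm unlock.
  have -> : C%:E = ((C ^+ 2)%:E `^ 2^-1)%E.
    by rewrite poweR12_sqrt ?lee_fin ?sqr_ge0//= sqrtr_sqr ger0_norm.
  apply: gt0_ler_poweR => //.
  - by rewrite in_itv/= leey integral_ge0// => x _; rewrite poweR_ge0.
  - by rewrite in_itv/= leey lee_fin sqr_ge0.
  apply: le_trans fC; rewrite le_eqVlt; apply/orP; left; apply/eqP.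
  by apply: eq_integral => x _ /=; rewrite powR_mulrn// real_normK ?num_real.
have Lf : L2 mu f.
  rewrite /L2/= inE; apply/andP; split; rewrite inE//=.
  by rewrite /finite_norm (le_lt_trans NC)// ltry.
by split => //; rewrite -lee_fin -L2normE.
Qed.

(** Fatou's lemma for the squares: an almost everywhere limit inherits both membership in L^2 and
    the norm bound, with no dominating function. *)
Lemma nrm_liminf (w : nat -> T -> R) f (C : R) :
  (forall n, L2 mu (w n)) -> measurable_fun setT f -> 0 <= C ->
  (\forall n \near \oo, nrm (w n) <= C) ->
  (\forall x \ae mu, w ^~ x @ \oo --> f x) -> L2 mu f /\ nrm f <= C.
Proof.
move=> Lw mf C0 wC wf; apply: L2_of_integral_sqr => //.
pose u n x := (w n x ^+ 2)%:E.
have mu_ n : measurable_fun setT (u n).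
  by apply/measurable_EFinP/measurable_funX; exact: L2_measurable.
have u0 n x : setT x -> (0 <= u n x)%E by rewrite lee_fin sqr_ge0.
have := fatou mu measurableT mu_ u0.
have minf : measurable_fun setT (fun x => limn_einf (u ^~ x)).
  rewrite (_ : (fun _ => _) = fun x => - limn_esup (fun n => - (u n x)))%E; last first.
    apply/funext => x; rewrite -limn_einfN; congr limn_einf.
    by apply/funext => n; exact/esym/oppeK.
  apply: measurableT_comp => //; apply: measurable_fun_limn_esup => n.
  exact: measurableT_comp.
have -> : (\int[mu]_x limn_einf (u ^~ x) = \int[mu]_x (f x ^+ 2)%:E)%E.
  apply: ae_eq_integral => //.
    by apply/measurable_EFinP/measurable_funX.
  apply: filterS wf => x wx _.
  have ufx : u ^~ x @ \oo --> (f x ^+ 2)%:E.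
    by apply/cvg_EFin; [exact: nearW|apply: cvgM].
  by rewrite is_cvg_limn_einfE ?(cvg_lim _ ufx)//; apply/cvg_ex; eexists; exact: ufx.
move=> /le_trans; apply.
rewrite limn_einf_lim; apply: lime_le.
  by apply: is_cvg_einfs.
have [N _ HN] := wC; exists N => // n /= Nn.
apply: (@le_trans _ _ (\int[mu]_x u n x)%E).
  by apply: ereal_inf_lbound; exists n => /=.
rewrite (_ : (\int[mu]_x _ = (ip (w n) (w n))%:E)%E); last first.
  rewrite /ip /Rintegral fineK; first by apply: eq_integral => x _; rewrite /u expr2.
  by apply: integrable_fin_num => //; exact: L2_mul_integrable.
by rewrite lee_fin -nrm2 ler_pXn2r ?nnegrE ?nrm_ge0//; apply: HN.
Qed.

Lemma series_normr_fin_cvg (v : nat -> R) :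
  (\big[+%E/0]_(0 <= k <oo) `|v k.+1 - v k|%:E)%E \is a fin_num ->
  cvgn v.
Proof.
set S := (X in X \is a fin_num) => Sfin.
have c : cvgn [normed series (fun k => v k.+1 - v k)].
  apply: nondecreasing_is_cvgn.
    move=> m n; apply: nondecreasing_series => i _ _; exact: normr_ge0.
  exists (fine S) => _ [n _ <-].
  rewrite -lee_fin fineK// /series/= -sumEFin.
  exact: nneseries_lim_ge.
have {c} /cvg_ex[l sl] := normed_cvg c.
apply/cvg_ex; exists (l + v 0%N).
have vE : (fun n => series (fun k => v k.+1 - v k) n + v 0%N) = v.
  by apply/funext => n; rewrite seriesEnat/= telescope_sumr// subrK.
by rewrite -[X in X @ _]vE; apply: cvgD => //; exact: cvg_cst.
Qed.

(** The core of Riesz-Fischer: the sum of the absolute increments has integral at most the sum of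
    the 1 / 2^(k+1), so it is finite almost everywhere and [v] converges pointwise there. *)
Lemma L2_fast_cvg (v : nat -> T -> R) : (forall n, L2 mu (v n)) ->
  (forall k m, (k <= m)%N -> nrm (v m - v k) <= (2 ^+ k.+1)^-1) ->
  exists2 f, L2 mu f & forall k, nrm (v k - f) <= (2 ^+ k.+1)^-1.
Proof.
move=> Lv vC.
pose D x := (\big[+%E/0]_(0 <= k <oo) `|v k.+1 x - v k x|%:E)%E.
have mv k : measurable_fun setT (v k) by exact: L2_measurable.
have mD0 k : measurable_fun setT (fun x => `|v k.+1 x - v k x|%:E).
  by apply/measurable_EFinP/measurableT_comp => //; exact: measurable_funB.
have mD : measurable_fun setT D by apply: ge0_emeasurable_sum.
have iD : mu.-integrable setT D.
  apply/integrableP; split => //.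
  under eq_integral do rewrite gee0_abs ?nneseries_ge0//.
  rewrite integral_nneseries//.
  apply: (@le_lt_trans _ _ (\sum_(0 <= k <oo) (1 / (2 ^ k.+1)%:R)%:E)%E).
    apply: lee_nneseries => [k _ _|k _]; first exact: integral_ge0.
    rewrite natrX div1r; apply: le_trans (_ : ((nrm (v k.+1 - v k))%:E <= _)%E).
      rewrite -[leLHS]/(\int[mu]_x `|((v k.+1 - v k) x)%:E|)%E.
      by apply: integral_normr_le_nrm; exact: L2_B.
    by rewrite lee_fin vC.
  by apply: le_lt_trans (epsilon_trick0 xpredT ler01) _; rewrite ltry.
(* The limsup is measurable everywhere, and is the limit almost everywhere. *)
pose f x := fine (limn_esup (fun k => (v k x)%:E)).
have mf : measurable_fun setT f.
  apply: (measurableT_comp (fine_measurable measurableT)).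
  by apply: measurable_fun_limn_esup => k; exact/measurable_EFinP.
have vf : \forall x \ae mu, v ^~ x @ \oo --> f x.
  apply: filterS (integrable_ae measurableT iD) => x /(_ I).
  move=> /series_normr_fin_cvg /cvg_ex[l vl].
  suff -> : f x = l by [].
  rewrite /f (_ : limn_esup _ = l%:E)//.
  suff /cvg_limn_einf_sup[] : (fun k => (v k x)%:E) @ \oo --> l%:E by [].
  by apply/cvg_EFin => //; exact: nearW.
(* [f - v k] is the pointwise limit of [v m - v k] as m grows, and the Cauchy bound on the latter
   does not depend on m. *)
have main k : L2 mu (f - v k) /\ nrm (f - v k) <= (2 ^+ k.+1)^-1.
  apply: (@nrm_liminf (fun m => v m - v k)).
  - by move=> m; exact: L2_B.
  - exact: measurable_funB.
  - by rewrite invr_ge0 exprn_ge0.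
  - by exists k => // m /= km; exact: vC.
  - apply: filterS vf => x vx.
    rewrite (_ : (fun m => (v m - v k) x) = (fun m => v m x - v k x))//.
    by apply: cvgB => //; exact: cvg_cst.
exists f; first by rewrite -(subrK (v 0%N) f); apply: L2_D => //; apply main.
by move=> k; rewrite nrm_distC; apply main.
Qed.

Lemma L2_complete (u : nat -> T -> R) : (forall n, L2 mu (u n)) ->
  (forall e : R, 0 < e ->
    exists N, forall m n, (N <= m)%N -> (N <= n)%N -> nrm (u m - u n) <= e) ->
  exists2 f, L2 mu f &
    forall e : R, 0 < e -> exists N, forall n, (N <= n)%N -> nrm (u n - f) <= e.
Proof.
move=> Lu uC.
have e0 k : 0 < (2 ^+ k.+1)^-1 :> R by rewrite invr_gt0 exprn_gt0.
have /choice[N HN] : forall k, exists N, forall m n,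
    (N <= m)%N -> (N <= n)%N -> nrm (u m - u n) <= (2 ^+ k.+1)^-1.
  by move=> k; exact: uC.
(* Partial sums give indices that are nondecreasing in k and still at least [N k]. *)
pose p k := (\sum_(i < k.+1) N i)%N.
have Np k : (N k <= p k)%N by rewrite /p big_ord_recr/= leq_addl.
have pp k m : (k <= m)%N -> (p k <= p m)%N.
  move=> /subnK <-; elim: (m - k)%N => [//|i IH].
  by rewrite addSn (leq_trans IH)// /p [leqRHS]big_ord_recr/= leq_addr.
have [f Lf fC] := @L2_fast_cvg (fun k => u (p k)) (fun k => Lu _)
  (fun k m km => HN k _ _ (leq_trans (Np k) (pp _ _ km)) (Np k)).
exists f => // e epos.
have [k ke] : exists k, (2 ^+ k.+1)^-1 <= e / 2 :> R.
  have := @cvg_geometric R 1 2^-1.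
  rewrite ger0_norm ?invr_ge0// invf_lt1// ltr1n => /(_ isT)/cvgr0Pnorm_le.
  move=> /(_ (e / 2) ltac:(lra)) [k _ /(_ k.+1 (leqnSn k))] ke.
  by exists k; rewrite /= mul1r exprVn ger0_norm in ke.
exists (N k) => n kn.
have h1 : nrm (u n - u (p k)) <= e / 2 by apply: le_trans ke; exact: HN.
have h2 : nrm (u (p k) - f) <= e / 2 by apply: le_trans ke; exact: fC.
have := nrm_triangle (L2_B (Lu n) (Lu (p k))) (L2_B (Lu (p k)) Lf).
rewrite subrKA; lra.
Qed.

Lemma L20_complete (u : nat -> T -> R) : (forall n, L20 mu (u n)) ->
  (forall e : R, 0 < e ->
    exists N, forall m n, (N <= m)%N -> (N <= n)%N -> nrm (u m - u n) <= e) ->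
  exists2 f, L20 mu f &
    forall e : R, 0 < e -> exists N, forall n, (N <= n)%N -> nrm (u n - f) <= e.
Proof.
move=> Lu /(L2_complete (fun n => (Lu n).1))[f Lf uf]; exists f => //; split=> //.
(* The mean is the inner product with the constant 1, so the mean of f differs from that of [u N],
   which is 0, by at most the distance of the two functions. *)
apply/eqP; rewrite -normr_le0; apply/ler_addgt0Pr => e e0; rewrite add0r.
have [N /(_ N (leqnn _))] := uf _ e0; apply: le_trans.
have [LN uN] := Lu N; rewrite L2_mean_ip in uN.
rewrite L2_mean_ip -[ip _ _]subr0 -uN -ip_Bl//; last exact: L2_cst.
apply: le_trans (ip_CS (L2_B Lf LN) (L2_cst mu 1)) _.
by rewrite nrm_cst1 mulr1 nrm_distC.
Qed.

End L2_complete.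

(* The factor [w^-1 + h] comes from [1 - exp (- w h) >= w h / (1 + w h)]. *)
Lemma sum_expR_le (R : realType) (w h : R) (a b : nat) : 0 < w -> 0 < h ->
  h * \sum_(a <= k < b) expR (- w * (k%:R * h)) <=
    expR (- w * (a%:R * h)) * (w^-1 + h).
Proof.
move=> w0 h0; have wi : 0 < w^-1 by rewrite invr_gt0.
have [ab|ba] := leqP a b; last first.
  by rewrite big_geq 1?ltnW// mulr0 mulr_ge0 ?expR_ge0// addr_ge0 ?ltW.
(* A discrete primitive: each term of the sum is at most an increment of [e], and the increments
   telescope. *)
pose e (k : nat) := (w^-1 + h) * - expR (- w * (k%:R * h)).
have -> : expR (- w * (a%:R * h)) * (w^-1 + h) = - e a by rewrite /e; ring.
apply: (@le_trans _ _ (e b - e a)); last first.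
  rewrite gerDr /e mulrN oppr_le0 mulr_ge0 ?expR_ge0// addr_ge0 ?ltW//.
rewrite -telescope_sumr// mulr_sumr; apply: ler_sum => k _.
rewrite /e -[in X in _ <= X]natr1.
have -> : - w * ((k%:R + 1) * h) = - w * (k%:R * h) + - (w * h) by ring.
rewrite expRD; set x := expR (- w * _).
have -> : (w^-1 + h) * - (x * expR (- (w * h))) - (w^-1 + h) * - x =
  x * ((w^-1 + h) * (1 - expR (- (w * h)))) by ring.
rewrite mulrC ler_wpM2l ?expR_ge0//.
have := expR_ge1Dx (w * h); rewrite expRN.
have : 0 < expR (w * h) by exact: expR_gt0.
set y := expR _ => y0 yw.
have -> : h = (w^-1 + h) * (w * h / (1 + w * h)).
  by field; rewrite !gt_eqF// addr_gt0// mulr_gt0.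
rewrite -{1}(_ : w^-1 + h = (w^-1 + (w^-1 + h) * (w * h / (1 + w * h)))); last first.
  by field; rewrite !gt_eqF// addr_gt0// mulr_gt0.
have wh0 : 0 <= w^-1 + h by rewrite addr_ge0// ltW.
rewrite ler_wpM2l//.
have p : 0 < 1 + w * h by rewrite addr_gt0// mulr_gt0.
have -> : w * h / (1 + w * h) = 1 - (1 + w * h)^-1.
  by field; rewrite gt_eqF.
by rewrite lerD2l lerN2 lef_pV2 ?posrE.
Qed.

(** * Surjectivity of the generator of an exponentially stable semigroup *)

(* [V] is a space of functions rather than of classes: the seminorm [N] need
   not separate points, and identities between elements of [D] are stated as
   the vanishing of [N] on a difference. *)
Section exponentially_stable_semigroup.
Context (R : realType) (V : lmodType R).
Variables (D : set V) (N : V -> R) (S : R -> V -> V) (M w : R).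
Implicit Types (x y z H : V) (c e t s r h : R) (a b K : nat).
Local Notation dist x y := (N (x - y)).
Hypothesis D_0 : D 0.
Hypothesis D_lin : forall c x y, D x -> D y -> D (c *: x + y).
Hypothesis N_ge0 : forall x, 0 <= N x.
Hypothesis N_Z : forall c x, D x -> N (c *: x) = `|c| * N x.
Hypothesis N_D : forall x y, D x -> D y -> N (x + y) <= N x + N y.
Hypothesis complete : forall u : nat -> V, (forall n, D (u n)) ->
  (forall e, 0 < e ->
    exists n0, forall m n, (n0 <= m)%N -> (n0 <= n)%N -> dist (u m) (u n) <= e) ->
  exists2 x, D x &
    forall e, 0 < e -> exists n0, forall n, (n0 <= n)%N -> dist (u n) x <= e.
Hypothesis M1 : 1 <= M.
Hypothesis w0 : 0 < w.
Hypothesis S_D : forall t x, 0 <= t -> D x -> D (S t x).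
Hypothesis S_lin : forall t c x y, 0 <= t -> D x -> D y ->
  dist (S t (c *: x + y)) (c *: S t x + S t y) = 0.
Hypothesis S_add : forall s t x, 0 <= s -> 0 <= t -> D x ->
  dist (S (s + t) x) (S s (S t x)) = 0.
Hypothesis S_bd : forall t x, 0 <= t -> D x ->
  N (S t x) <= M * expR (- w * t) * N x.
Hypothesis S_cont : forall x, D x -> forall e, 0 < e ->
  exists2 r, 0 < r & forall t, 0 <= t -> t <= r -> dist (S t x) x <= e.

Let D_Z c x : D x -> D (c *: x).
Proof. by move=> Dx; rewrite -[_ *: _]addr0; exact: D_lin. Qed.

Let D_D x y : D x -> D y -> D (x + y).
Proof. by move=> Dx; rewrite -[x]scale1r; exact: D_lin. Qed.

Let D_B x y : D x -> D y -> D (x - y).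
Proof. by move=> Dx Dy; rewrite addrC -scaleN1r; exact: D_lin. Qed.

Let D_sum a b (x : nat -> V) : (forall k, D (x k)) -> D (\sum_(a <= k < b) x k).
Proof. by move=> Dx; apply: big_ind => // y z; exact: D_D. Qed.

Let N_0 : N 0 = 0. Proof. by rewrite -(scale0r 0) N_Z// normr0 mul0r. Qed.

Let distxx x : dist x x = 0. Proof. by rewrite subrr N_0. Qed.

Let distC x y : D x -> D y -> dist x y = dist y x.
Proof.
by move=> Dx Dy; rewrite -[x - y]opprB -[- (y - x)]scaleN1r N_Z ?normrN1 ?mul1r//; exact: D_B.
Qed.

Let dist_tri y x z : D x -> D y -> D z -> dist x z <= dist x y + dist y z.
Proof. by move=> ? ? ?; rewrite -(subrKA y x) N_D//; exact: D_B. Qed.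

Let distD x y x' y' : D x -> D y -> D x' -> D y' ->
  dist (x + x') (y + y') <= dist x y + dist x' y'.
Proof. by move=> *; rewrite opprD addrACA N_D//; exact: D_B. Qed.

Let distZ c x y : D x -> D y -> dist (c *: x) (c *: y) = `|c| * dist x y.
Proof. by move=> *; rewrite -scalerBr N_Z//; exact: D_B. Qed.

Let dist_sum a b (x y : nat -> V) : (forall k, D (x k)) -> (forall k, D (y k)) ->
  dist (\sum_(a <= k < b) x k) (\sum_(a <= k < b) y k) <=
    \sum_(a <= k < b) dist (x k) (y k).
Proof.
move=> Dx Dy; elim: b => [|b IH]; first by rewrite !big_geq// distxx.
have [ab|ab] := leqP a b; last by rewrite !big_geq// distxx.
rewrite !big_nat_recr//=; apply: le_trans (distD (D_sum a b Dx) (D_sum a b Dy) (Dx b) (Dy b)) _.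
by rewrite lerD2r.
Qed.

Let S_dist s x y : 0 <= s -> D x -> D y ->
  dist (S s x) (S s y) <= M * expR (- w * s) * dist x y.
Proof.
move=> s0 Dx Dy; have := S_lin (-1) s0 Dy Dx.
rewrite !scaleN1r [- y + x]addrC [- _ + S s x]addrC => e.
have Du : D (S s x - S s y) by apply: D_B; exact: S_D.
have Dv : D (S s (x - y)) by apply: S_D => //; exact: D_B.
have := dist_tri Du Dv D_0; rewrite (distC Du Dv) e add0r !subr0 => /le_trans; apply.
by apply: S_bd => //; exact: D_B.
Qed.

(** Continuity at time s is continuity at time 0 damped by the decay factor. This makes
    discretisation errors summable over an unbounded time horizon. *)
Let S_shift s r x : 0 <= s -> 0 <= r -> D x ->
  dist (S (s + r) x) (S s x) <= M * expR (- w * s) * dist (S r x) x.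
Proof.
move=> s0 r0 Dx; have Dr := S_D r0 Dx.
have Dsr : D (S (s + r) x) by apply: S_D => //; exact: addr_ge0.
apply: le_trans (dist_tri Dsr (S_D s0 Dr) (S_D s0 Dx)) _.
by rewrite S_add// add0r S_dist.
Qed.

Section resolvent.
Variable H : V.
Hypothesis DH : D H.

Let sum_ h a b := \sum_(a <= k < b) S (k%:R * h) H.

Let D_S h (k : nat) : 0 < h -> D (S (k%:R * h) H).
Proof. by move=> h0; apply: S_D => //; rewrite mulr_ge0// ltW. Qed.

Let D_sum_ h a b : 0 < h -> D (sum_ h a b).
Proof. by move=> h0; apply: D_sum => k; exact: D_S. Qed.

Let S_sum t h K : 0 <= t -> 0 < h ->
  dist (S t (h *: sum_ h 0 K)) (h *: \sum_(0 <= k < K) S (t + k%:R * h) H) = 0.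
Proof.
move=> t0 h0; apply/le_anti; rewrite N_ge0 andbT.
have Dt k : D (S (t + k%:R * h) H).
  by apply: S_D => //; rewrite addr_ge0// mulr_ge0// ltW.
elim: K => [|K IH].
  rewrite /sum_ !big_geq// scaler0 subr0.
  by apply: le_trans (S_bd t0 D_0) _; rewrite N_0 mulr0.
rewrite /sum_ !big_nat_recr//= !scalerDr ![_ + h *: S _ H]addrC.
have DK := D_S K h0; have Dsum := D_Z h (D_sum_ 0 K h0).
have Dsum' := D_Z h (D_sum 0 K Dt).
have StK := S_D t0 DK; have StS := S_D t0 Dsum.
apply: le_trans (dist_tri (S_D t0 (D_lin h DK Dsum)) (D_lin h StK StS)
  (D_lin h (Dt K) Dsum')) _.
rewrite S_lin// add0r.
apply: le_trans (distD (D_Z h StK) (D_Z h (Dt K)) StS Dsum') _.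
rewrite distZ// distC// S_add ?mulr0 ?add0r//.
by rewrite mulr_ge0// ltW.
Qed.

Let tail h a b : 0 < h ->
  N (h *: sum_ h a b) <= M * N H * (expR (- w * (a%:R * h)) * (w^-1 + h)).
Proof.
move=> h0; rewrite N_Z; last exact: D_sum_.
rewrite gtr0_norm// -[sum_ _ _ _]subr0.
have -> : 0 = \sum_(a <= k < b) (0 : V) by rewrite big1.
apply: le_trans (_ : h * \sum_(a <= k < b) M * N H * expR (- w * (k%:R * h)) <= _).
  rewrite ler_wpM2l ?(ltW h0)//; apply: le_trans (dist_sum _ _ _ _) _ => //.
    by move=> k; exact: D_S.
  apply: ler_sum => k _; rewrite subr0 mulrAC; apply: S_bd => //.
  by rewrite mulr_ge0// ltW.
rewrite -mulr_sumr mulrCA ler_wpM2l ?sum_expR_le//.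
by rewrite mulr_ge0// (le_trans ler01).
Qed.

(** Every fine grid point is compared with the coarse grid point to its left. By [S_shift] the error
    there is [M * e] times a decay factor, and the decay factors sum up to a bound that does not
    involve the horizon [K]. *)
Let refine h (b K : nat) e : 0 < h -> (0 < b)%N ->
  (forall t, 0 <= t -> t <= h -> dist (S t H) H <= e) ->
  dist ((h / b%:R) *: sum_ (h / b%:R) 0 (K * b)) (h *: sum_ h 0 K) <=
    M * e * (w^-1 + h).
Proof.
move=> h0 b0 He; set g := h / b%:R.
have br0 : 0 < b%:R :> R by rewrite ltr0n.
have g0 : 0 < g by rewrite divr_gt0.
have e0 : 0 <= e by apply: le_trans (He 0 _ _) => //; exact: ltW.
(* Each coarse term is repeated b times, so that both sums run over the same fine grid. *)
have -> : h *: sum_ h 0 K =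
   g *: \sum_(0 <= i < K) \sum_(i * b <= j < i.+1 * b) S (i%:R * h) H.
  rewrite /sum_ !scaler_sumr; apply: eq_bigr => i _.
  rewrite big_const_nat iter_addr addr0 mulSn addnK.
  rewrite -[X in g *: X]scaler_nat scalerA.
  by rewrite /g divfK// gt_eqF.
rewrite distZ; [|exact: D_sum_|]; last first.
  by do 2 (apply: D_sum => ?); exact: D_S.
rewrite /sum_ big_nat_mul gtr0_norm//.
apply: le_trans (_ : g * \sum_(0 <= i < K) \sum_(i * b <= j < i.+1 * b)
   M * e * expR (- w * (i%:R * h)) <= _).
  rewrite ler_wpM2l ?(ltW g0)//; apply: le_trans (dist_sum _ _ _ _) _.
  - by move=> i; apply: D_sum => ?; exact: D_S.
  - by move=> i; apply: D_sum => ?; exact: D_S.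
  apply: ler_sum => i _; apply: le_trans (dist_sum _ _ _ _) _.
  - by move=> ?; exact: D_S.
  - by move=> ?; exact: D_S.
  rewrite big_nat [leRHS]big_nat; apply: ler_sum => j /andP[ij ji].
  have ih0 : 0 <= i%:R * h by rewrite mulr_ge0// ltW.
  have -> : j%:R * g = i%:R * h + (j - i * b)%:R * g.
    rewrite natrB// natrM /g mulrBl addrCA.
    by rewrite [X in _ - X](_ : _ = i%:R * h) ?subrr ?addr0//; field; rewrite gt_eqF.
  have jg : 0 <= (j - i * b)%:R * g by rewrite mulr_ge0// ltW.
  apply: le_trans (S_shift ih0 jg DH) _.
  rewrite mulrAC ler_wpM2r ?expR_ge0// ler_wpM2l ?(le_trans ler01)//.
  apply: He => //; rewrite /g mulrCA ler_piMr ?(ltW h0)//.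
  rewrite ler_pdivrMr// mul1r ler_nat.
  by rewrite leq_subLR -mulSnr ltnW.
under eq_bigr do rewrite big_const_nat iter_addr addr0 mulSn addnK -[_ *+ b]mulr_natr.
rewrite -mulr_suml -mulr_sumr.
rewrite (_ : g * _ = M * e * (h * \sum_(0 <= i < K) expR (- w * (i%:R * h)))).
  rewrite ler_wpM2l//; first by rewrite mulr_ge0// (le_trans ler01).
  apply: le_trans (sum_expR_le 0 K w0 h0) _.
  by rewrite mul0r mulr0 expR0 mul1r.
by rewrite /g; field; rewrite gt_eqF.
Qed.

(* Dyadic Riemann sums of int_0^n S_s H ds; their limit [x] satisfies
   (S_t x - x) / t --> - H. *)
Let h_ n : R := (2 ^+ n)^-1.
Let F n := h_ n *: sum_ (h_ n) 0 (n * 2 ^ n).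
Let C := M * (w^-1 + 1).

Let h_gt0 n : 0 < h_ n. Proof. by rewrite invr_gt0 exprn_gt0. Qed.

Let h_le1 n : h_ n <= 1.
Proof. by rewrite invf_le1 ?exprn_gt0// exprn_ege1// ler1n. Qed.

Let M0 : 0 <= M. Proof. exact: le_trans ler01 M1. Qed.

Let C_ge0 : 0 <= C.
Proof. by rewrite mulr_ge0// addr_ge0// invr_ge0 ltW. Qed.

Let D_F n : D (F n). Proof. by apply: D_Z; exact: D_sum_. Qed.

Let wh_le n : M * (w^-1 + h_ n) <= C.
Proof. by rewrite ler_wpM2l// lerD2l. Qed.

Let tail_F n b :
  N (h_ n *: sum_ (h_ n) (n * 2 ^ n) b) <= C * N H * expR (- w * n%:R).
Proof.
apply: le_trans (tail _ _ (h_gt0 n)) _.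
rewrite natrM natrX mulfK ?expf_neq0//.
have -> : M * N H * (expR (- w * n%:R) * (w^-1 + h_ n)) =
  (M * (w^-1 + h_ n)) * (N H * expR (- w * n%:R)) by ring.
by rewrite -[leRHS]mulrA ler_wpM2r ?wh_le// mulr_ge0 ?expR_ge0.
Qed.

Let F_cauchy n m e : (n <= m)%N ->
  (forall t, 0 <= t -> t <= h_ n -> dist (S t H) H <= e) ->
  dist (F m) (F n) <= C * e + C * N H * expR (- w * n%:R).
Proof.
move=> nm He.
have e0 : 0 <= e by apply: le_trans (He 0 _ _) => //; exact: ltW.
(* [G] has the mesh of [F n] and the horizon of [F m]: it separates the mesh error, treated by
   [refine], from the truncation error, treated by [tail_F]. *)
pose G := h_ n *: sum_ (h_ n) 0 (m * 2 ^ n).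
have DG : D G by apply: D_Z; exact: D_sum_.
apply: le_trans (dist_tri (D_F m) DG (D_F n)) _; apply: lerD.
  have b0 : (0 < 2 ^ (m - n))%N by rewrite expn_gt0.
  have := refine (m * 2 ^ n) (h_gt0 n) b0 He.
  have -> : h_ n / (2 ^ (m - n))%:R = h_ m.
    by rewrite /h_ natrX -invfM -exprD subnKC.
  rewrite -mulnA -expnD subnKC// => /le_trans; apply.
  by rewrite mulrAC ler_wpM2r ?wh_le.
rewrite /G /F -scalerBr /sum_ (@big_cat_nat _ _ _ (n * 2 ^ n) 0 (m * 2 ^ n))//=.
  by rewrite addrAC subrr add0r; exact: tail_F.
by rewrite leq_mul2r nm orbT.
Qed.

Let small_expR c e : 0 < e -> \forall n \near \oo, c * expR (- w * n%:R) <= e.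
Proof.
move=> e0; have q1 : `|expR (- w)| < 1.
  by rewrite ger0_norm ?expR_ge0// expR_lt1 oppr_lt0.
have /cvgr0Pnorm_le/(_ e e0) := cvg_geometric c q1.
by apply: filterS => n /=; rewrite -expRM_natr => /(le_trans (ler_norm _)).
Qed.

Let small_h c e : 0 < e -> \forall n \near \oo, c * h_ n <= e.
Proof.
move=> e0; have q1 : `|2^-1 : R| < 1 by rewrite ger0_norm// invf_lt1// ltr1n.
have /cvgr0Pnorm_le/(_ e e0) := cvg_geometric c q1.
by apply: filterS => n /=; rewrite exprVn => /(le_trans (ler_norm _)).
Qed.

Let small_shift e : 0 < e ->
  \forall n \near \oo, forall t, 0 <= t -> t <= h_ n -> dist (S t H) H <= e.
Proof.
move=> e0; have [r r0 rH] := S_cont DH e0.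
apply: filterS (small_h 1 r0) => n; rewrite mul1r => nr t t0 tn.
by apply: rH => //; exact: le_trans nr.
Qed.

(** Applying [S t] translates the integral defining x by t, so S_t x - x is minus the integral of
    S_s H over [0, t]; there S_s H stays close to H. *)
Lemma generator_surjective : exists2 x, D x &
  forall e, 0 < e -> exists2 r, 0 < r &
    forall t, 0 < t -> t <= r -> N (t^-1 *: (S t x - x) + H) <= e.
Proof.
have [x Dx Fx] : exists2 x, D x &
    forall e, 0 < e -> exists n0, forall n, (n0 <= n)%N -> dist (F n) x <= e.
  apply: complete => // e e0.
  have C1 : 0 < 4 * (C + 1) by have := C_ge0; lra.
  have e'0 : 0 < e / (4 * (C + 1)) by rewrite divr_gt0.
  have e4 : 0 < e / 4 by lra.
  have [n0 _ Hn0] := filterI (small_shift e'0) (small_expR (C * N H) e4).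
  exists n0.
  have [Hs He] := Hn0 n0 (leqnn _).
  have Fn n : (n0 <= n)%N -> dist (F n) (F n0) <= e / 2.
    move=> /F_cauchy /(_ Hs) /le_trans; apply.
    apply: le_trans (_ : e / 4 + e / 4 <= _); last by lra.
    apply: lerD => //.
    by rewrite mulrA ler_pdivrMr//; lra.
  move=> m n mn nn; apply: le_trans (dist_tri (D_F m) (D_F n0) (D_F n)) _.
  by rewrite (distC (D_F n0) (D_F n)) [leRHS]splitr lerD// Fn.
exists x => // e e0; have [r r0 rH] := S_cont DH e0.
exists r => // t t0 tr.
have t0' := ltW t0.
have DSx := S_D t0' Dx.
suff main : N (S t x - x + t *: H) <= t * e.
  rewrite -[H](@scalerK _ _ t) ?gt_eqF// -scalerDr N_Z; last first.
    by apply: D_D; [exact: D_B|exact: D_Z].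
  by rewrite ger0_norm ?invr_ge0// mulrC ler_pdivrMr// [e * t]mulrC.
(* From here t is fixed and the mesh is refined: [eta] absorbs all discretisation errors, none of
   which has to be compared with t. *)
apply/ler_addgt0Pr => eta eta0.
have [n1 Hn1] := Fx (eta / (4 * (M + 1))) ltac:(rewrite divr_gt0//; have := M0; lra).
have ea : 0 < eta / (8 * (C + 1)) by rewrite divr_gt0//; have := C_ge0; lra.
have eb : 0 < eta / 8 by lra.
have [n2 _ Hn2] := filterI (small_shift ea)
  (filterI (small_expR (C * N H) eb) (small_h (N H) eb)).
pose n := maxn n1 n2.
have [Hs [He Hh]] := Hn2 n (leq_maxr _ _).
have {}Hn1 := Hn1 n (leq_maxl _ _).
set h := h_ n in Hs Hh.
have h0 : 0 < h := h_gt0 n.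
(* t is rounded down to the grid, since translation by t does not preserve the grid but translation
   by [j * h] does. *)
pose j := Num.truncn (t / h).
have /andP[jt tj] : j%:R * h <= t < j.+1%:R * h.
  rewrite -ler_pdivlMr// -ltr_pdivrMr//.
  by apply: truncn_itv; rewrite divr_ge0// ltW.
pose K := (n * 2 ^ n)%N.
have DSh a b : D (h *: sum_ h a b) by apply: D_Z; exact: D_sum_.
(* The sum [F n] translated by j grid steps, a stand-in for [S t (F n)]. *)
pose y := h *: sum_ h j (j + K).
have a1 : dist (S t x) (S t (F n)) <= M * (eta / (4 * (M + 1))).
  apply: le_trans (S_dist t0' Dx (D_F n)) _.
  rewrite distC//; apply: ler_pM => //; first by rewrite mulr_ge0 ?expR_ge0.
  by rewrite ler_piMr// -expR0 ler_expR mulNr oppr_le0 mulr_ge0// ltW.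
have a2 : dist (S t (F n)) y <= C * (eta / (8 * (C + 1))).
  pose z := h *: \sum_(0 <= k < K) S (t + k%:R * h) H.
  have Dt (k : nat) : D (S (t + k%:R * h) H).
    by apply: S_D => //; rewrite addr_ge0// mulr_ge0// ltW.
  have Dz : D z by apply: D_Z; exact: D_sum.
  have Dy : D y := DSh _ _.
  apply: le_trans (dist_tri (S_D t0' (D_F n)) Dz Dy) _.
  have -> : y = h *: \sum_(0 <= k < K) S ((k + j)%:R * h) H.
    by rewrite /y /sum_ -[in LHS](add0n j) add0n -{1}[j]add0n big_addn addKn.
  rewrite S_sum// add0r /z.
  have DSk (k : nat) : D (S ((k + j)%:R * h) H) by exact: D_S.
  rewrite distZ; [|exact: D_sum|exact: D_sum].
  rewrite gtr0_norm//.
  apply: le_trans (_ : h * \sum_(0 <= k < K)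
    M * (eta / (8 * (C + 1))) * expR (- w * (k%:R * h)) <= _).
    rewrite ler_wpM2l ?(ltW h0)//.
    apply: le_trans (dist_sum 0 K Dt DSk) _; apply: ler_sum => k _.
    have kj0 : 0 <= (k + j)%:R * h by rewrite mulr_ge0// ltW.
    have tj0 : 0 <= t - j%:R * h by rewrite subr_ge0.
    have -> : t + k%:R * h = (k + j)%:R * h + (t - j%:R * h).
      by rewrite natrD; ring.
    apply: le_trans (S_shift kj0 tj0 DH) _.
    rewrite [leRHS]mulrAC; apply: ler_pM => //.
    - by rewrite mulr_ge0 ?expR_ge0.
    - rewrite ler_wpM2l// ler_expR ler_wnM2l ?oppr_le0 ?(ltW w0)//.
      by rewrite ler_wpM2r ?(ltW h0)// ler_nat leq_addr.
    - apply: Hs => //; rewrite lerBlDr (le_trans (ltW tj))//.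
      by rewrite -natr1 mulrDl mul1r addrC.
  rewrite -mulr_sumr mulrCA.
  have -> : C * (eta / (8 * (C + 1))) = M * (eta / (8 * (C + 1))) * (w^-1 + 1).
    by rewrite /C mulrAC.
  rewrite ler_wpM2l//; first by rewrite mulr_ge0// ltW.
  apply: le_trans (sum_expR_le 0 K w0 h0) _.
  by rewrite mul0r mulr0 expR0 mul1r lerD2l h_le1.
have a3 : N (y - F n + t *: H) <= t * e + eta / 8 + eta / 8.
  (* The translated window loses the first j terms, which together are close to [t *: H], and gains
     j terms beyond the horizon, which are small. *)
  have -> : y - F n + t *: H = (t *: H - h *: sum_ h 0 j) + h *: sum_ h K (j + K).
    have E : h *: sum_ h 0 j + y = F n + h *: sum_ h K (j + K).
      rewrite /y /F -!scalerDr /sum_ -!big_cat_nat//; [exact: leq_addl|exact: leq_addr].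
    have -> : y = F n + h *: sum_ h K (j + K) - h *: sum_ h 0 j.
      by rewrite -E [_ + y]addrC addrK.
    by rewrite -[F n + _ - _]addrA [F n + _]addrC addrK [LHS]addrC addrA addrAC.
  apply: le_trans (N_D (D_B (D_Z t DH) (DSh 0 j)) (DSh _ _)) _.
  apply: lerD; last exact: le_trans (tail_F _ _) He.
  apply: le_trans (dist_tri (D_Z t DH) (D_Z (j%:R * h) DH) (DSh 0 j)) _.
  rewrite addrC; apply: lerD; last first.
    rewrite -scalerBl N_Z// mulrC; apply: le_trans Hh.
    rewrite ler_wpM2l// ger0_norm ?subr_ge0// lerBlDr (le_trans (ltW tj))//.
    by rewrite -natr1 mulrDl mul1r addrC.
  have -> : (j%:R * h) *: H = h *: \sum_(0 <= k < j) H.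
    by rewrite big_const_nat iter_addr addr0 subn0 -[H *+ j]scaler_nat scalerA mulrC.
  rewrite distZ; [|exact: D_sum|exact: D_sum_].
  rewrite gtr0_norm//; apply: (@le_trans _ _ (j%:R * h * e)); last first.
    by rewrite ler_wpM2r// ltW.
  rewrite -mulrA mulrCA ler_wpM2l ?(ltW h0)//.
  have Dk (k : nat) : D (S (k%:R * h) H) by exact: D_S.
  apply: le_trans (dist_sum 0 j (fun=> DH) Dk) _.
  have -> : j%:R * e = \sum_(0 <= k < j) e.
    by rewrite big_const_nat iter_addr addr0 subn0 mulr_natl.
  rewrite big_nat [leRHS]big_nat; apply: ler_sum => k /andP[_ kj].
  have kh0 : 0 <= k%:R * h by rewrite mulr_ge0// ltW.
  rewrite distC//; apply: rH => //; apply: le_trans tr; apply: le_trans jt.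
  by rewrite ler_wpM2r ?(ltW h0)// ler_nat ltnW.
have a4 : N (S t x - x + t *: H) <=
   dist (S t x) (S t (F n)) + dist (S t (F n)) y + N (y - F n + t *: H) + dist (F n) x.
  have DSF := S_D t0' (D_F n).
  have Dy : D y := DSh _ _.
  have DyF : D (y - F n + t *: H) by apply: D_D; [exact: D_B|exact: D_Z].
  have -> : S t x - x + t *: H = (S t x - S t (F n)) + (S t (F n) - y) +
      (y - F n + t *: H) + (F n - x).
    by rewrite subrKA [_ + (y - F n + _)]addrA subrKA [RHS]addrAC subrKA.
  apply: le_trans (N_D _ (D_B (D_F n) Dx)) _.
    by apply: D_D => //; apply: D_D; exact: D_B.
  rewrite lerD2r; apply: le_trans (N_D _ DyF) _.
    by apply: D_D; exact: D_B.
  by rewrite lerD2r; apply: N_D; exact: D_B.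
have b1 : M * (eta / (4 * (M + 1))) <= eta / 4.
  rewrite mulrA ler_pdivrMr; last by have := C_ge0; have := M0; lra.
  by have := M0; nra.
have b2 : C * (eta / (8 * (C + 1))) <= eta / 8.
  rewrite mulrA ler_pdivrMr; last by have := C_ge0; have := M0; lra.
  by have := C_ge0; have := M0; nra.
have b3 : eta / (4 * (M + 1)) <= eta / 4.
  rewrite ler_pdivrMr; last by have := C_ge0; have := M0; lra.
  by have := C_ge0; have := M0; nra.
lra.
Qed.

End resolvent.

End exponentially_stable_semigroup.

(** * Contraction semigroups on L^2 and their generators, up to null functions *)

Section semigroup_L2.
Context (d : measure_display) (T : measurableType d) (R : realType).
Variable mu : probability T R.
Implicit Types (f g h : T -> R) (a b : R).
Local Notation ip := (ip mu).
Local Notation nrm := (nrm mu).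

Lemma near_right0P (P : R -> Prop) : (\forall t \near (0 : R)^'+, P t) <->
  exists2 r, 0 < r & forall t, 0 < t -> t <= r -> P t.
Proof.
split=> [[e /= e0 He]|[r r0 Hr]].
  exists (e / 2); first by rewrite divr_gt0.
  move=> t t0 te; apply: He => //=.
  rewrite sub0r normrN gtr0_norm// (le_lt_trans te)//.
  by rewrite ltr_pdivrMr// ltr_pMr// ltr1n.
exists r => // t /=; rewrite sub0r normrN => /[swap] t0.
by rewrite gtr0_norm// => /ltW; exact: Hr.
Qed.

Lemma L2norm_cvg0P (u : R -> T -> R) : (forall t, 0 < t -> L2 mu (u t)) ->
  (L2norm mu (u t) @[t --> (0 : R)^'+] --> 0%E) <->
  (forall e, 0 < e -> exists2 r, 0 < r &
    forall t, 0 < t -> t <= r -> nrm (u t) <= e).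
Proof.
move=> Lu.
have uE : \forall t \near (0 : R)^'+, L2norm mu (u t) = (nrm (u t))%:E.
  by apply: (proj2 (near_right0P _)); exists 1 => // t t0 _; apply: L2normE; exact: Lu.
split=> [/fine_cvgP[_ /cvgr0Pnorm_le uc] e e0|uc].
  have [r r0 Hr] := proj1 (near_right0P _) (filterI uE (uc e e0)).
  exists r => // t t0 tr; have [tE] := Hr _ t0 tr.
  by rewrite /= tE/= ger0_norm// nrm_ge0.
apply: (@cvg_trans _ ((nrm (u t))%:E @[t --> (0 : R)^'+])).
  apply: near_eq_cvg; apply: filterS uE => t ->//.
apply/cvg_EFin; first exact: nearW.
apply/cvgr0Pnorm_le => e e0; apply: (proj2 (near_right0P _)).
have [r r0 Hr] := uc e e0; exists r => // t t0 tr /=.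
by rewrite ger0_norm ?nrm_ge0//; exact: Hr.
Qed.

Lemma nrm_tri g f h : L2 mu f -> L2 mu g -> L2 mu h ->
  nrm (f - h) <= nrm (f - g) + nrm (g - h).
Proof. by move=> ? ? ?; rewrite -(subrKA g f) nrm_triangle//; exact: L2_B. Qed.

Lemma nrm_addB f f' g g' : L2 mu f -> L2 mu f' -> L2 mu g -> L2 mu g' ->
  nrm ((f + f') - (g + g')) <= nrm (f - g) + nrm (f' - g').
Proof. by move=> *; rewrite opprD addrACA nrm_triangle//; exact: L2_B. Qed.

Variable Q : R -> (T -> R) -> (T -> R).
Hypothesis cQ : contraction_semigroup mu Q.

Lemma semigroup_nrm_le t f : 0 <= t -> L2 mu f -> nrm (Q t f) <= nrm f.
Proof.
move=> t0 Lf; rewrite -lee_fin -!L2normE//; last exact: (semigroup_L2 cQ).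
exact: (semigroup_contraction cQ).
Qed.

Lemma semigroup_nrm_lin t a f g : 0 <= t -> L2 mu f -> L2 mu g ->
  nrm (Q t (a *: f + g) - (a *: Q t f + Q t g)) = 0.
Proof.
move=> t0 Lf Lg; apply: ae_eq_nrmB.
- by apply: (semigroup_L2 cQ) => //; exact: L2_lin.
- by apply: L2_lin; exact: (semigroup_L2 cQ).
- exact: (semigroup_linear cQ).
Qed.

Lemma semigroup_nrm_add s t f : 0 <= s -> 0 <= t -> L2 mu f ->
  nrm (Q (s + t) f - Q s (Q t f)) = 0.
Proof.
move=> s0 t0 Lf; have Lt := semigroup_L2 cQ t0 Lf.
apply: ae_eq_nrmB; [|exact: (semigroup_L2 cQ)|exact: (semigroupD cQ)].
by apply: (semigroup_L2 cQ) => //; exact: addr_ge0.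
Qed.

Lemma semigroup_nrmB t f g : 0 <= t -> L2 mu f -> L2 mu g ->
  nrm (Q t (f - g) - (Q t f - Q t g)) = 0.
Proof.
move=> t0 Lf Lg; have := semigroup_nrm_lin (-1) t0 Lg Lf.
by rewrite !scaleN1r [- g + f]addrC [- _ + Q t f]addrC.
Qed.

Lemma semigroup_nrmZ t a f : 0 <= t -> L2 mu f ->
  nrm (Q t (a *: f) - a *: Q t f) = 0.
Proof.
move=> t0 Lf; have L0 := L2_0 mu.
have L1 := semigroup_L2 cQ t0 (L2_Z a Lf).
have L2 := L2_Z a (semigroup_L2 cQ t0 Lf); have L3 := semigroup_L2 cQ t0 L0.
apply/le_anti; rewrite nrm_ge0 andbT.
apply: le_trans (nrm_tri L1 (L2_D L2 L3) L2) _.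
have := semigroup_nrm_lin a t0 Lf L0; rewrite addr0 => ->.
rewrite add0r addrAC subrr add0r -(nrm0 mu); exact: semigroup_nrm_le.
Qed.

Lemma semigroup_nrm_comm s t f : 0 <= s -> 0 <= t -> L2 mu f ->
  nrm (Q s (Q t f) - Q t (Q s f)) = 0.
Proof.
move=> s0 t0 Lf; have st0 := addr_ge0 s0 t0.
have Ls := semigroup_L2 cQ s0 Lf; have Lt := semigroup_L2 cQ t0 Lf.
apply/le_anti; rewrite nrm_ge0 andbT.
apply: le_trans (nrm_tri (semigroup_L2 cQ s0 Lt) (semigroup_L2 cQ st0 Lf)
  (semigroup_L2 cQ t0 Ls)) _.
have := semigroup_nrm_add t0 s0 Lf; rewrite [t + s]addrC => ->.
by rewrite nrm_distC semigroup_nrm_add// addr0.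
Qed.

Lemma nrm_eq_trans f g : L2 mu f -> L2 mu g -> nrm (f - g) = 0 -> nrm f = nrm g.
Proof. by move=> Lf Lg /(nrm_ae_eq Lf Lg); exact: ae_eq_nrm. Qed.

Lemma semigroup_dist t f g : 0 <= t -> L2 mu f -> L2 mu g ->
  nrm (Q t f - Q t g) <= nrm (f - g).
Proof.
move=> t0 Lf Lg; have Lfg := L2_B Lf Lg.
rewrite -(nrm_eq_trans _ _ (semigroup_nrmB t0 Lf Lg)).
- exact: semigroup_nrm_le.
- exact: (semigroup_L2 cQ).
- by apply: L2_B; exact: (semigroup_L2 cQ).
Qed.

Lemma semigroup_cvg0 f : L2 mu f -> forall e, 0 < e ->
  exists2 r, 0 < r & forall t, 0 <= t -> t <= r -> nrm (Q t f - f) <= e.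
Proof.
move=> Lf e e0.
have Lt t : 0 < t -> L2 mu (Q t f - f).
  by move=> t0; apply: L2_B => //; apply: (semigroup_L2 cQ) => //; exact: ltW.
have /(L2norm_cvg0P Lt)/(_ e e0)[r r0 Hr] := semigroup_continuous cQ Lf.
exists r => // t; rewrite le_eqVlt => /predU1P[<- _|]; last exact: Hr.
rewrite ae_eq_nrmB//; [exact: ltW|exact: (semigroup_L2 cQ)|exact: (semigroup0 cQ)].
Qed.

Lemma is_generatorP f g : is_generator mu Q f g <->
  [/\ L2 mu f, L2 mu g & forall e, 0 < e -> exists2 r, 0 < r &
    forall t, 0 < t -> t <= r -> nrm (t^-1 *: (Q t f - f) - g) <= e].
Proof.
suff H : L2 mu f -> L2 mu g -> (forall t, 0 < t -> L2 mu (t^-1 *: (Q t f - f) - g)).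
  split=> [[Lf Lg fg]|[Lf Lg fg]]; split => //;
   by apply/(L2norm_cvg0P (H Lf Lg)).
move=> Lf Lg t t0; apply: L2_B => //; apply: L2_Z; apply: L2_B => //.
by apply: (semigroup_L2 cQ) => //; exact: ltW.
Qed.

Lemma is_generator_unique f g g' :
  is_generator mu Q f g -> is_generator mu Q f g' -> nrm (g - g') = 0.
Proof.
move=> /is_generatorP[Lf Lg fg] /is_generatorP[_ Lg' fg'].
apply/le_anti; rewrite nrm_ge0 andbT; apply/ler_addgt0Pr => e e0; rewrite add0r.
have e2 : 0 < e / 2 by lra.
have [r r0 Hr] := fg _ e2; have [r' r'0 Hr'] := fg' _ e2.
pose t := Num.min r r'.
have t0 : 0 < t by rewrite lt_min r0.
have Lq : L2 mu (t^-1 *: (Q t f - f)).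
  by apply: L2_Z; apply: L2_B => //; apply: (semigroup_L2 cQ) => //; exact: ltW.
have := Hr _ t0; rewrite ge_min lexx => /(_ isT).
have := Hr' _ t0; rewrite ge_min lexx orbT => /(_ isT).
have := nrm_tri Lg Lq Lg'; rewrite (nrm_distC _ g (_ *: _)); lra.
Qed.

Lemma is_generator_gen f g : is_generator mu Q f g ->
  is_generator mu Q f (gen mu Q f) /\ nrm (gen mu Q f - g) = 0.
Proof.
move=> fg; have H : is_generator mu Q f (gen mu Q f).
  by rewrite /gen; case: xgetP => [y _ //|/(_ g)].
by split => //; exact: is_generator_unique H fg.
Qed.

Lemma is_generator_lin a f g f' g' : is_generator mu Q f g ->
  is_generator mu Q f' g' -> is_generator mu Q (a *: f + f') (a *: g + g').
Proof.
move=> /is_generatorP[Lf Lg fg] /is_generatorP[Lf' Lg' fg'].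
apply/is_generatorP; split => [||e e0]; [exact: L2_lin|exact: L2_lin|].
have a1 : 0 < 2 * (`|a| + 1) by have := normr_ge0 a; lra.
have [r r0 Hr] := fg (e / (2 * (`|a| + 1))) (divr_gt0 e0 a1).
have [r' r'0 Hr'] := fg' (e / 2) (divr_gt0 e0 (ltr0Sn R 1)).
exists (Num.min r r'); first by rewrite lt_min r0.
move=> t t0; rewrite le_min => /andP[tr tr'].
have {}Hr := Hr _ t0 tr; have {}Hr' := Hr' _ t0 tr'.
have t0' := ltW t0.
have Lt := semigroup_L2 cQ t0' Lf; have Lt' := semigroup_L2 cQ t0' Lf'.
have Lq := L2_Z t^-1 (L2_B Lt Lf); have Lq' := L2_Z t^-1 (L2_B Lt' Lf').
have Ll := L2_lin a Lq Lq'; have Lb := L2_lin a Lf Lf'.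
have Lc := semigroup_L2 cQ t0' Lb.
have Lql := L2_Z t^-1 (L2_B Lc Lb).
apply: le_trans (nrm_tri Lql Ll (L2_lin a Lg Lg')) _.
have -> : nrm (t^-1 *: (Q t (a *: f + f') - (a *: f + f')) -
  (a *: (t^-1 *: (Q t f - f)) + t^-1 *: (Q t f' - f'))) = 0.
  have -> : t^-1 *: (Q t (a *: f + f') - (a *: f + f')) -
    (a *: (t^-1 *: (Q t f - f)) + t^-1 *: (Q t f' - f')) =
    t^-1 *: (Q t (a *: f + f') - (a *: Q t f + Q t f')).
    by apply/funext => x; rewrite !fctE/= /GRing.scale/=; ring.
  by rewrite nrmZ ?semigroup_nrm_lin ?mulr0//; apply: L2_B => //; exact: L2_lin.
rewrite add0r; apply: le_trans (nrm_addB _ _ _ _) _ => //; try exact: L2_Z.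
rewrite [e]splitr lerD// -scalerBr nrmZ; last exact: L2_B.
apply: le_trans (ler_wpM2l (normr_ge0 a) Hr) _.
rewrite mulrA ler_pdivrMr//; have := normr_ge0 a; nra.
Qed.

(** [Q s] commutes with the difference quotient and contracts. Hence the quotients along the whole
    orbit of f converge at the rate observed at f itself, uniformly in s. *)
Lemma semigroup_quotient_le s t f g : 0 <= s -> 0 < t -> L2 mu f -> L2 mu g ->
  nrm (t^-1 *: (Q t (Q s f) - Q s f) - Q s g) <= nrm (t^-1 *: (Q t f - f) - g).
Proof.
move=> s0 t0 Lf Lg.
have Ls := semigroup_L2 cQ s0 Lf; have Lsg := semigroup_L2 cQ s0 Lg.
have t0' := ltW t0.
have Lt := semigroup_L2 cQ t0' Lf.
have LB := L2_B Lt Lf.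
have Lq := L2_Z t^-1 LB.
have Lts := semigroup_L2 cQ t0' Ls.
have Lst := semigroup_L2 cQ s0 Lt.
have Lsq := semigroup_L2 cQ s0 Lq.
have LsB := semigroup_L2 cQ s0 LB.
have Lq' := L2_Z t^-1 (L2_B Lts Ls).
apply: le_trans (nrm_tri Lq' Lsq Lsg) _.
rewrite -[leRHS]add0r; apply: lerD; last exact: semigroup_dist.
have Lz := L2_Z t^-1 LsB.
apply: le_trans (nrm_tri Lq' Lz Lsq) _.
rewrite (nrm_distC _ (_ *: Q s _)) semigroup_nrmZ// addr0 -scalerBr.
have LB' := L2_B Lts Ls; have LB'' := L2_B Lst Ls.
rewrite nrmZ; last exact: L2_B.
apply: mulr_ge0_le0; first exact: normr_ge0.
apply: le_trans (nrm_tri LB' LB'' LsB) _.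
rewrite (nrm_distC _ (_ - _) (Q s _)) semigroup_nrmB// addr0.
have -> : Q t (Q s f) - Q s f - (Q s (Q t f) - Q s f) = Q t (Q s f) - Q s (Q t f).
  by rewrite opprB addrA subrK.
by rewrite semigroup_nrm_comm.
Qed.

Lemma is_generator_semigroup s f g : 0 <= s -> is_generator mu Q f g ->
  is_generator mu Q (Q s f) (Q s g).
Proof.
move=> s0 /is_generatorP[Lf Lg fg]; apply/is_generatorP.
split => [||e e0]; [exact: (semigroup_L2 cQ)|exact: (semigroup_L2 cQ)|].
have [r r0 Hr] := fg e e0; exists r => // t t0 tr.
by apply: le_trans (Hr _ t0 tr); exact: semigroup_quotient_le.
Qed.

End semigroup_L2.

(** * Real and imaginary parts of exp (t (a + i b)), and their right derivatives at 0 *)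

Section complex_exponential.
Context (R : realType) (a b : R).

Definition expcos (t : R) : R := expR (a * t) * cos (b * t).
Definition expsin (t : R) : R := expR (a * t) * sin (b * t).

Lemma is_derive0_right (f : R -> R) (l : R) : is_derive (0 : R) 1 f l ->
  forall e, 0 < e -> exists2 r, 0 < r &
    forall t, 0 < t -> t <= r -> `|t^-1 * (f t - f 0) - l| <= e.
Proof.
move=> [df fl] e e0.
have /cvgrPdist_le/(_ e e0) : h^-1 *: (f (h *: 1 + 0) - f 0) @[h --> (0 : R)^'] --> l.
  by rewrite -fl; exact: df.
move=> [r /= r0 Hr]; exists (r / 2); first by rewrite divr_gt0.
move=> t t0 tr; have := Hr t; rewrite /= sub0r normrN gtr0_norm// distrC addr0.
rewrite [X in f X](_ : _ = t) /GRing.scale/= ?mulr1//; apply; last by rewrite gt_eqF.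
by rewrite (le_lt_trans tr)// ltr_pdivrMr// ltr_pMr// ltr1n.
Qed.

Lemma is_derive_expcos0 : is_derive (0 : R) 1 expcos a.
Proof.
rewrite /expcos; apply: is_derive_eq.
by rewrite /GRing.scale/= !mulr0 expR0 cos0 sin0; ring.
Qed.

Lemma is_derive_expsin0 : is_derive (0 : R) 1 expsin b.
Proof.
rewrite /expsin; apply: is_derive_eq.
by rewrite /GRing.scale/= !mulr0 expR0 cos0 sin0; ring.
Qed.

Lemma expcos_right e : 0 < e -> exists2 r, 0 < r &
  forall t, 0 < t -> t <= r -> `|t^-1 * (expcos t - 1) - a| <= e.
Proof.
move=> e0; have := is_derive0_right is_derive_expcos0 e0.
by rewrite {2}/expcos !mulr0 expR0 cos0 mulr1.
Qed.

Lemma expsin_right e : 0 < e -> exists2 r, 0 < r &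
  forall t, 0 < t -> t <= r -> `|t^-1 * expsin t - b| <= e.
Proof.
move=> e0; have [r r0 Hr] := is_derive0_right is_derive_expsin0 e0.
exists r => // t t0 tr; have := Hr t t0 tr.
by rewrite {2}/expsin !mulr0 expR0 sin0 mulr0 subr0.
Qed.

End complex_exponential.

(** * Invariance of mean-zero functions, and solution of the complex resolvent equation *)

Section markov.
Context (d : measure_display) (T : measurableType d) (R : realType).
Variables (mu : probability T R) (Q : R -> (T -> R) -> (T -> R)).
Hypothesis mQ : markov_semigroup mu Q.
Implicit Types (f g h : T -> R) (a b c : R).
Local Notation ip := (ip mu).
Local Notation nrm := (nrm mu).
Let cQ : contraction_semigroup mu Q := mQ.1.

Lemma markov_cst1 t : 0 <= t -> Q t (cst 1) = cst 1 %[ae mu].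
Proof.
move=> t0; have [p /(_ t t0)[_ /(_ _ (L2_cst mu 1))]] := mQ.2.
apply: filterS => x /= /[apply] ->.
by rewrite Rintegral_cst// mul1r prob_kernel.
Qed.

(* A contraction fixing [1] has an adjoint fixing [1]: expand
   |Q (e f + 1)|^2 <= |e f + 1|^2 to first order in e. *)
Lemma markov_mean t f : 0 <= t -> L2 mu f ->
  \int[mu]_x Q t f x = \int[mu]_x f x.
Proof.
move=> t0 Lf; rewrite !L2_mean_ip.
have L1 := L2_cst mu 1; have Lt := semigroup_L2 cQ t0 Lf.
have Lt1 := semigroup_L2 cQ t0 L1.
set A := ip (Q t f) _; set B := ip f _.
have key e : e ^+ 2 * nrm (Q t f) ^+ 2 + 2 * e * A <= e ^+ 2 * nrm f ^+ 2 + 2 * e * B.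
  have Le := L2_lin e Lf L1; have LeQ := L2_lin e Lt L1.
  have LQe := semigroup_L2 cQ t0 Le.
  have : nrm (e *: Q t f + cst 1) <= nrm (e *: f + cst 1).
    rewrite -(ae_eq_nrm LQe LeQ); first exact: semigroup_nrm_le.
    have := semigroup_linear cQ t0 e Lf L1; apply: filterS2 (markov_cst1 t0).
    by move=> x /(_ I) Q1 /(_ I) ->; rewrite Q1.
  rewrite -(@ler_pXn2r _ 2)// ?nnegrE ?nrm_ge0// !nrm2.
  rewrite !ip_linl// !(ipC _ _ (_ *: _ + _)) !ip_linl//.
  rewrite !(ipC _ (cst 1)) -/A -/B -!nrm2; lra.
set k := nrm f ^+ 2 - nrm (Q t f) ^+ 2.
have k0 : 0 <= k.
  by rewrite subr_ge0 ler_pXn2r// ?nnegrE ?nrm_ge0//; exact: semigroup_nrm_le.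
have {}key e : 2 * e * (A - B) <= e ^+ 2 * k by have := key e; rewrite /k; lra.
apply/eqP; rewrite -subr_eq0; apply/negPn/negP => AB.
have x2 : 0 < (A - B) ^+ 2 by rewrite exprn_even_gt0.
have k1 : 0 < k + 1 by lra.
(* Small enough for the linear term to win: multiplied by [(k + 1) ^+ 2], the inequality reads 2 (A
   - B)^2 (k + 1) <= (A - B)^2 k. The summand 1 keeps the denominator positive when k vanishes. *)
have := key ((A - B) / (k + 1)).
rewrite -(ler_pM2r (exprn_gt0 2 k1)).
have -> : 2 * ((A - B) / (k + 1)) * (A - B) * (k + 1) ^+ 2 = 2 * (A - B) ^+ 2 * (k + 1).
  by field; lra.
have -> : ((A - B) / (k + 1)) ^+ 2 * k * (k + 1) ^+ 2 = (A - B) ^+ 2 * k.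
  by field; lra.
nra.
Qed.

Lemma markov_L20 t f : 0 <= t -> L20 mu f -> L20 mu (Q t f).
Proof.
move=> t0 [Lf f0]; split; first exact: (semigroup_L2 cQ).
by rewrite markov_mean.
Qed.

Section resolvent.
Variables (c a b : R).
Hypothesis decay : forall t f, 0 <= t -> L20 mu f ->
  nrm (Q t f) <= expR (- c * t) * nrm f.
Hypothesis ac : a < c.

(* The complexification of the real space is written as pairs (Re, Im);
   [rot t] is multiplication by exp (t (a + i b)). *)
Let V : lmodType R := ((T -> R) * (T -> R))%type.
Let D : set V := [set p | L20 mu p.1 /\ L20 mu p.2].
(** The sum of the two norms keeps componentwise estimates immediate. Rotations are not isometric
    for it but cost a factor 2, which becomes the constant [M] of the abstract result. *)
Let N (p : V) : R := nrm p.1 + nrm p.2.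
Let cmul (x y : R) (p : V) : V :=
  (x *: p.1 - y *: p.2, y *: p.1 + x *: p.2).
Let rot (t : R) : V -> V := cmul (expcos a b t) (expsin a b t).
Let QQ t (p : V) : V := (Q t p.1, Q t p.2).
Implicit Types (p q : V).

Let D_L2 p : D p -> L2 mu p.1 /\ L2 mu p.2.
Proof. by move=> [[? _] [? _]]. Qed.

Let D_0 : D 0. Proof. by split; exact: L20_0. Qed.

Let D_lin k p q : D p -> D q -> D (k *: p + q).
Proof. by move=> [p1 p2] [q1 q2]; split; exact: L20_lin. Qed.

Let N_ge0 p : 0 <= N p. Proof. by rewrite addr_ge0// nrm_ge0. Qed.

Let N_Z k p : D p -> N (k *: p) = `|k| * N p.
Proof. by move=> /D_L2[? ?]; rewrite /N/= !nrmZ// mulrDr. Qed.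

Let N_D p q : D p -> D q -> N (p + q) <= N p + N q.
Proof.
move=> /D_L2[p1 p2] /D_L2[q1 q2]; rewrite /N addrACA.
by apply: lerD; exact: nrm_triangle.
Qed.

Let D_Z k p : D p -> D (k *: p).
Proof. by move=> Dp; rewrite -[_ *: _]addr0; exact: D_lin. Qed.

Let D_D p q : D p -> D q -> D (p + q).
Proof. by move=> Dp; rewrite -[p]scale1r; exact: D_lin. Qed.

Let D_B p q : D p -> D q -> D (p - q).
Proof. by move=> Dp Dq; rewrite addrC -scaleN1r; exact: D_lin. Qed.

Let N_complete (u : nat -> V) : (forall n, D (u n)) ->
  (forall e, 0 < e -> exists n0, forall m n, (n0 <= m)%N -> (n0 <= n)%N ->
    N (u m - u n) <= e) ->
  exists2 p, D p &
    forall e, 0 < e -> exists n0, forall n, (n0 <= n)%N -> N (u n - p) <= e.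
Proof.
move=> Du uC.
have [f1 Lf1 uf1] := @L20_complete _ _ _ mu (fun n => (u n).1) (fun n => (Du n).1)
  (fun e e0 => let: ex_intro n0 Hn := uC e e0 in
    ex_intro _ n0 (fun m n mn nn => le_trans
      (ler_wpDr (nrm_ge0 mu (u m - u n).2) (lexx _)) (Hn m n mn nn))).
have [f2 Lf2 uf2] := @L20_complete _ _ _ mu (fun n => (u n).2) (fun n => (Du n).2)
  (fun e e0 => let: ex_intro n0 Hn := uC e e0 in
    ex_intro _ n0 (fun m n mn nn => le_trans
      (ler_wpDl (nrm_ge0 mu (u m - u n).1) (lexx _)) (Hn m n mn nn))).
exists (f1, f2) => // e e0; have e2 : 0 < e / 2 by lra.
have [n1 Hn1] := uf1 _ e2; have [n2 Hn2] := uf2 _ e2.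
exists (maxn n1 n2) => n; rewrite geq_max => /andP[n1n n2n].
by rewrite /N [e]splitr lerD//=; [exact: Hn1|exact: Hn2].
Qed.

Let D_rot t p : D p -> D (rot t p).
Proof.
move=> [p1 p2]; split; last by apply: L20_lin => //; exact: L20_Z.
by apply: L20_B; exact: L20_Z.
Qed.

Let D_QQ t p : 0 <= t -> D p -> D (QQ t p).
Proof. by move=> t0 [p1 p2]; split; exact: markov_L20. Qed.

Let rot_lin t k p q : rot t (k *: p + q) = k *: rot t p + rot t q.
Proof.
by congr pair; apply/funext => x; rewrite /= !fctE /GRing.scale/=; ring.
Qed.

Let rotB t p q : rot t (p - q) = rot t p - rot t q.
Proof. by rewrite addrC -scaleN1r rot_lin scaleN1r addrC. Qed.

Let rot_add s t p : rot (s + t) p = rot s (rot t p).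
Proof.
rewrite /rot/= /expcos /expsin !mulrDr expRD cosD sinD.
by congr pair; apply/funext => x; rewrite /= !fctE /GRing.scale/=; ring.
Qed.

Let rot0 p : rot 0 p = p.
Proof.
rewrite /rot/= /expcos /expsin !mulr0 expR0 cos0 sin0 !mulr1 mulr0 /cmul.
rewrite !scale1r !scale0r subr0 add0r; exact/esym/surjective_pairing.
Qed.

Let N_cmul x y p : D p -> N (cmul x y p) <= (`|x| + `|y|) * N p.
Proof.
move=> /D_L2[p1 p2].
have := nrm_triangle (L2_Z x p1) (L2_Z (-1) (L2_Z y p2)).
have := nrm_triangle (L2_Z y p1) (L2_Z x p2).
rewrite scaleN1r nrmN /N /= !nrmZ//; lra.
Qed.

Let rot_le (a' b' t : R) : `|expcos a' b' t| + `|expsin a' b' t| <= 2 * expR (a' * t).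
Proof.
have e0 := expR_ge0 (a' * t).
rewrite mulr_natl mulr2n; apply: lerD; rewrite normrM ger0_norm// ler_piMr//.
  by rewrite ler_norml cos_geN1 cos_le1.
by rewrite ler_norml sin_geN1 sin_le1.
Qed.

Let N_rot t p : D p -> N (rot t p) <= 2 * expR (a * t) * N p.
Proof.
by move=> Dp; apply: le_trans (N_cmul _ _ Dp) _; rewrite ler_wpM2r// rot_le.
Qed.

Let N_rot0 t p : D p -> N p = 0 -> N (rot t p) = 0.
Proof.
move=> Dp p0; apply/le_anti; rewrite N_ge0 andbT.
by apply: le_trans (N_rot t Dp) _; rewrite p0 mulr0.
Qed.

Let N_QQ t p : 0 <= t -> D p -> N (QQ t p) <= expR (- c * t) * N p.
Proof. by move=> t0 [p1 p2]; rewrite mulrDr lerD//; exact: decay. Qed.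

Let QQ_lin t k p q : 0 <= t -> D p -> D q ->
  N (QQ t (k *: p + q) - (k *: QQ t p + QQ t q)) = 0.
Proof.
move=> t0 /D_L2[p1 p2] /D_L2[q1 q2].
by rewrite /N /QQ /= !semigroup_nrm_lin// addr0.
Qed.

Let Q_lin2 t x y f g : 0 <= t -> L2 mu f -> L2 mu g ->
  nrm (Q t (x *: f + y *: g) - (x *: Q t f + y *: Q t g)) = 0.
Proof.
move=> t0 Lf Lg; have Lyg := L2_Z y Lg; have Qf := semigroup_L2 cQ t0 Lf.
have Qg := semigroup_L2 cQ t0 Lg; have Qyg := semigroup_L2 cQ t0 Lyg.
apply/le_anti; rewrite nrm_ge0 andbT.
apply: le_trans (nrm_tri (semigroup_L2 cQ t0 (L2_lin x Lf Lyg))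
  (L2_lin x Qf Qyg) (L2_lin x Qf (L2_Z y Qg))) _.
rewrite semigroup_nrm_lin// add0r.
apply: le_trans (nrm_addB (L2_Z x Qf) Qyg (L2_Z x Qf) (L2_Z y Qg)) _.
by rewrite subrr nrm0 add0r semigroup_nrmZ.
Qed.

Let QQ_rot s t p : 0 <= s -> D p -> N (QQ s (rot t p) - rot t (QQ s p)) = 0.
Proof.
move=> s0 /D_L2[p1 p2]; rewrite /N /QQ /rot /cmul /=.
rewrite -!scaleNr !Q_lin2// addr0//.
Qed.

Let N_tri q p r : D p -> D q -> D r -> N (p - r) <= N (p - q) + N (q - r).
Proof. by move=> Dp Dq Dr; rewrite -(subrKA q p) N_D//; exact: D_B. Qed.

(** The semigroup exp (t (a + i b)) Q_t, whose generator is L + a + i b and whose decay rate is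
    [c - a]. Solving the resolvent equation amounts to inverting this generator. *)
Let S t p := rot t (QQ t p).

Let S_D t p : 0 <= t -> D p -> D (S t p).
Proof. by move=> t0 Dp; apply: D_rot; exact: D_QQ. Qed.

Let S_lin t k p q : 0 <= t -> D p -> D q ->
  N (S t (k *: p + q) - (k *: S t p + S t q)) = 0.
Proof.
move=> t0 Dp Dq; rewrite /S -rot_lin -rotB; apply: N_rot0; last exact: QQ_lin.
by apply: D_B; [|apply: D_lin]; apply: D_QQ => //; exact: D_lin.
Qed.

Let S_add s t p : 0 <= s -> 0 <= t -> D p -> N (S (s + t) p - S s (S t p)) = 0.
Proof.
move=> s0 t0 Dp; rewrite /S rot_add -rotB.
have st0 := addr_ge0 s0 t0; have Dt := D_QQ t0 Dp; have Dst := D_QQ s0 Dt.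
have Dr := D_rot t Dt; have Dsr := D_QQ s0 Dr.
have DQ := D_QQ st0 Dp; have Drst := D_rot t Dst.
apply: N_rot0; first by apply: D_B => //; exact: D_rot.
apply/le_anti; rewrite N_ge0 andbT.
apply: le_trans (N_tri (D_rot t DQ) Drst Dsr) _.
have -> : N (rot t (QQ (s + t) p) - rot t (QQ s (QQ t p))) = 0.
  rewrite -rotB; apply: N_rot0; first exact: D_B.
  by have [p1 p2] := D_L2 Dp; rewrite /N/= !semigroup_nrm_add// addr0.
rewrite add0r -[X in N X]opprB -scaleN1r N_Z; last exact: D_B.
by rewrite QQ_rot// mulr0.
Qed.

Let w0 : 0 < c - a. Proof. by rewrite subr_gt0. Qed.

Let S_bd t p : 0 <= t -> D p -> N (S t p) <= 2 * expR (- (c - a) * t) * N p.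
Proof.
move=> t0 Dp; apply: le_trans (N_rot t (D_QQ t0 Dp)) _.
have -> : - (c - a) * t = a * t + - c * t by ring.
by rewrite expRD mulrA -[leRHS]mulrA ler_wpM2l ?N_QQ// mulr_ge0 ?expR_ge0.
Qed.

Let rot_small (a' b' : R) : exists2 r, 0 < r & forall t, 0 <= t -> t <= r ->
  `|expcos a' b' t - 1| + `|expsin a' b' t| <= (`|a'| + `|b'| + 2) * t.
Proof.
have [r1 r10 H1] := expcos_right a' b' ltr01.
have [r2 r20 H2] := expsin_right a' b' ltr01.
exists (Num.min r1 r2); first by rewrite lt_min r10.
move=> t; rewrite le_eqVlt => /predU1P[<- _|t0].
  by rewrite /expcos /expsin !mulr0 expR0 cos0 sin0 !mulr1 mulr0 subrr normr0 addr0.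
rewrite le_min => /andP[/(H1 _ t0) h1 /(H2 _ t0) h2].
have key x y : `|t^-1 * x - y| <= 1 -> `|x| <= (`|y| + 1) * t.
  move=> xy; have : `|t^-1 * x| <= `|y| + 1.
    by rewrite -[t^-1 * x](subrK y) (le_trans (ler_normD _ _))// addrC lerD2l.
  by rewrite normrM gtr0_norm ?invr_gt0// mulrC ler_pdivrMr.
have := key _ _ h1; have := key _ _ h2; lra.
Qed.

Let N_cmulB x y p : D p -> N (cmul x y p - p) <= (`|x - 1| + `|y|) * N p.
Proof.
move=> Dp; rewrite (_ : cmul x y p - p = cmul (x - 1) y p); first exact: N_cmul.
case: p {Dp} => p1 p2.
by congr pair; apply/funext => z; rewrite /= !fctE /GRing.scale/=; ring.
Qed.

Let N_QQ_cont p : D p -> forall e, 0 < e ->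
  exists2 r, 0 < r & forall t, 0 <= t -> t <= r -> N (QQ t p - p) <= e.
Proof.
move=> /D_L2[p1 p2] e e0; have e2 : 0 < e / 2 by lra.
have [r1 r10 H1] := semigroup_cvg0 cQ p1 e2.
have [r2 r20 H2] := semigroup_cvg0 cQ p2 e2.
exists (Num.min r1 r2); first by rewrite lt_min r10.
move=> t t0; rewrite le_min => /andP[/(H1 _ t0) h1 /(H2 _ t0) h2].
by rewrite [e]splitr lerD.
Qed.

Let S_cont p : D p -> forall e, 0 < e ->
  exists2 r, 0 < r & forall t, 0 <= t -> t <= r -> N (S t p - p) <= e.
Proof.
move=> Dp e e0.
pose A := 4 * expR `|a|; have A0 : 0 < A by rewrite mulr_gt0 ?expR_gt0.
pose B := 2 * (`|a| + `|b| + 2) * (N p + 1).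
have B0 : 0 < B.
  have Np1 : 0 < N p + 1 by have := N_ge0 p; lra.
  have ab0 : 0 < `|a| + `|b| + 2.
    by have := normr_ge0 a; have := normr_ge0 b; lra.
  by rewrite mulr_gt0// mulr_gt0.
have [r1 r10 H1] := N_QQ_cont Dp (divr_gt0 e0 A0).
have [r2 r20 H2] := rot_small a b.
exists (Num.min (Num.min r1 r2) (Num.min 1 (e / B))).
  by rewrite !lt_min r10 r20 ltr01 divr_gt0.
move=> t t0; rewrite !le_min => /andP[/andP[/(H1 _ t0) h1 /(H2 _ t0) h2] /andP[t1 te]].
apply: le_trans (N_tri (S_D t0 Dp) (D_rot t Dp) Dp) _.
rewrite /S -rotB [e]splitr; apply: lerD.
  apply: le_trans (N_rot _ (D_B (D_QQ t0 Dp) Dp)) _.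
  apply: (@le_trans _ _ (2 * expR `|a| * (e / A))); last first.
    by rewrite /A le_eqVlt; apply/orP; left; apply/eqP; field; rewrite gt_eqF// expR_gt0.
  apply: ler_pM => //.
  rewrite ler_wpM2l// ler_expR (le_trans (ler_norm _))// normrM ler_piMr//.
  by rewrite ger0_norm.
apply: le_trans (N_cmulB _ _ Dp) _.
apply: (@le_trans _ _ ((`|a| + `|b| + 2) * t * (N p + 1))).
  by apply: ler_pM => //; rewrite ?addr_ge0 ?normr_ge0// lerDl.
rewrite mulrAC; move: te; rewrite ler_pdivlMr// /B; lra.
Qed.

Let rotN t p : rot (- t) p = cmul (expcos (- a) (- b) t) (expsin (- a) (- b) t) p.
Proof. by rewrite /rot /expcos /expsin !mulrN !mulNr. Qed.

(* F = F1 + i F2 solves (- L - (a + i b)) F = H1 + i H2. *)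
Lemma resolvent_pair (H1 H2 : T -> R) : L20 mu H1 -> L20 mu H2 ->
  exists F1 F2, [/\ L20 mu F1, L20 mu F2,
    is_generator mu Q F1 (- (H1 + (a *: F1 - b *: F2))) &
    is_generator mu Q F2 (- (H2 + (b *: F1 + a *: F2)))].
Proof.
move=> LH1 LH2; pose H : V := (H1, H2); have DH : D H by [].
have M1 : 1 <= 2 :> R by rewrite ler1n.
have [F DF HF] := generator_surjective D_0 D_lin N_ge0 N_Z N_D N_complete M1 w0
  S_D S_lin S_add S_bd S_cont DH.
have DaF : D (cmul a b F) by move: DF => [? ?]; split;
  [apply: L20_B|apply: L20_D]; exact: L20_Z.
suff main e : 0 < e -> exists2 r, 0 < r & forall t, 0 < t -> t <= r ->
    N (t^-1 *: (QQ t F - F) - - (H + cmul a b F)) <= e.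
  have [LF1 LF2] := D_L2 DF; have [LaF1 LaF2] := D_L2 DaF.
  have LN f : L2 mu f -> L2 mu (- f) by move=> Lf; rewrite -scaleN1r; exact: L2_Z.
  exists F.1, F.2; split; [by case: DF|by case: DF| |].
    apply/(is_generatorP cQ); split => //; first by apply/LN/L2_D => //; exact: LH1.1.
    move=> e /main[r r0 Hr]; exists r => // t t0 tr.
    by apply: le_trans (Hr t t0 tr); rewrite lerDl nrm_ge0.
  apply/(is_generatorP cQ); split => //; first by apply/LN/L2_D => //; exact: LH2.1.
  move=> e /main[r r0 Hr]; exists r => // t t0 tr.
  by apply: le_trans (Hr t t0 tr); rewrite lerDr nrm_ge0.
move=> e0.
(* [A], [B] and [E] grant each of the three errors below a share e / 3; the summands 1 in [B] and
   [E] keep these denominators positive. *)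
pose A := 6 * expR `|a|; have A0 : 0 < A by rewrite mulr_gt0 ?expR_gt0.
pose B := 6 * (N F + 1); have B0 : 0 < B by rewrite mulr_gt0//; have := N_ge0 F; lra.
pose E := 3 * (`|- a| + `|- b| + 2) * (N H + 1).
have E0 : 0 < E.
  have NH1 : 0 < N H + 1 by have := N_ge0 H; lra.
  have ab0 : 0 < `|- a| + `|- b| + 2.
    by have := normr_ge0 (- a); have := normr_ge0 (- b); lra.
  by rewrite mulr_gt0// mulr_gt0.
have [r1 r10 h1] := HF _ (divr_gt0 e0 A0).
have [r2 r20 h2] := rot_small (- a) (- b).
have [r3 r30 h3] := expcos_right (- a) (- b) (divr_gt0 e0 B0).
have [r4 r40 h4] := expsin_right (- a) (- b) (divr_gt0 e0 B0).
exists (Num.min (Num.min (Num.min r1 r2) (Num.min r3 r4)) (Num.min 1 (e / E))).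
  by rewrite !lt_min r10 r20 r30 r40 ltr01 divr_gt0.
move=> t t0; rewrite !le_min => /andP[/andP[/andP[tr1 tr2] /andP[tr3 tr4]] /andP[t1 te]].
have t0' := ltW t0.
have {}h1 := h1 _ t0 tr1; have {}h2 := h2 _ t0' tr2.
have {}h3 := h3 _ t0 tr3; have {}h4 := h4 _ t0 tr4.
set X := t^-1 *: (S t F - F) + H in h1.
pose x := t^-1 * (expcos (- a) (- b) t - 1) - - a.
pose y := t^-1 * expsin (- a) (- b) t - - b.
have DX : D X by apply: D_lin => //; apply: D_B => //; exact: S_D.
(* The twist is undone by [rot (- t)]. The three terms are the generator error of [S] at F, the
   error in differentiating [rot (- t)] at t = 0, and the displacement of H by [rot (- t)]. *)
have -> : t^-1 *: (QQ t F - F) - - (H + cmul a b F) =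
    rot (- t) X + cmul x y F - (rot (- t) H - H).
  have -> : rot (- t) X = t^-1 *: (QQ t F - rot (- t) F) + rot (- t) H.
    by rewrite /X rot_lin rotB /S -rot_add addNr rot0.
  rewrite !rotN /x /y /cmul.
  by congr pair; apply/funext => z; rewrite /= !fctE /GRing.scale/=; ring.
have Dr := D_rot (- t) DX; have Dxy : D (cmul x y F).
  by move: DF => [? ?]; split; [apply: L20_B|apply: L20_D]; exact: L20_Z.
have DrH := D_rot (- t) DH; have DHH := D_B DrH DH.
have -> : e = e / 3 + e / 3 + e / 3 by lra.
rewrite -scaleN1r; apply: le_trans (N_D (D_D Dr Dxy) (D_Z (-1) DHH)) _.
rewrite N_Z// normrN1 mul1r; apply: lerD.
  apply: le_trans (N_D Dr Dxy) _; apply: lerD.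
    rewrite rotN; apply: le_trans (N_cmul _ _ DX) _.
    apply: (@le_trans _ _ (2 * expR `|a| * (e / A))); last first.
      by rewrite /A le_eqVlt; apply/orP; left; apply/eqP; field; rewrite gt_eqF// expR_gt0.
    apply: ler_pM => //.
    apply: le_trans (rot_le _ _ _) _; rewrite ler_wpM2l// ler_expR.
    by rewrite (le_trans (ler_norm _))// normrM normrN ler_piMr// ger0_norm.
  apply: le_trans (N_cmul _ _ DF) _.
  apply: (@le_trans _ _ ((e / B + e / B) * (N F + 1))).
    by apply: ler_pM => //; [exact: lerD|rewrite lerDl].
  rewrite /B le_eqVlt; apply/orP; left; apply/eqP; field.
  by rewrite gt_eqF//; have := N_ge0 F; lra.
rewrite rotN; apply: le_trans (N_cmulB _ _ DH) _.
apply: (@le_trans _ _ ((`|- a| + `|- b| + 2) * t * (N H + 1))).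
  by apply: ler_pM => //; rewrite ?addr_ge0 ?normr_ge0// lerDl.
rewrite mulrAC; move: te; rewrite ler_pdivlMr// /E; lra.
Qed.

End resolvent.

End markov.

(** * From a Poincare inequality to exponential decay and a spectral gap *)

Section poincare.
Context (d : measure_display) (T : measurableType d) (R : realType).
Variables (mu : probability T R) (Q : R -> (T -> R) -> (T -> R)).
Hypothesis mQ : markov_semigroup mu Q.
Implicit Types (f g : T -> R) (a b e h s t : R).
Local Notation ip := (ip mu).
Local Notation nrm := (nrm mu).
Let cQ : contraction_semigroup mu Q := mQ.1.

(* For [F = (1 - L)^-1 f], the function [F - (Q_t F - F) / t] lies in the domain
   and tends to [F - L F = f]. *)
Lemma Dom_dense f e : L20 mu f -> 0 < e ->
  exists f' g', [/\ L20 mu f', is_generator mu Q f' g' & nrm (f - f') <= e].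
Proof.
move=> Lf e0.
have decay0 t g : 0 <= t -> L20 mu g -> nrm (Q t g) <= expR (- 0 * t) * nrm g.
  move=> t0 [Lg _]; rewrite oppr0 mul0r expR0 mul1r; exact: semigroup_nrm_le.
have [F [F2 [LF _ FG _]]] := resolvent_pair mQ 0 decay0 (ltrN10 R) Lf (L20_0 mu).
have [LF2 LG Fr] := (is_generatorP cQ _ _).1 FG.
have [r r0 Hr] := Fr _ e0.
have r0' := ltW r0; have LQ := markov_L20 mQ r0' LF.
have FQ := is_generator_semigroup cQ r0' FG.
have LB : L20 mu (r^-1 *: (Q r F - F)) by apply: L20_Z; exact: L20_B.
exists (F - r^-1 *: (Q r F - F)); eexists; split.
- exact: L20_B.
- have E : F - r^-1 *: (Q r F - F) = (- r^-1) *: (-1 *: F + Q r F) + F.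
    by apply/funext => x; rewrite /= !fctE /GRing.scale/=; ring.
  by rewrite E; exact: (is_generator_lin cQ _ (is_generator_lin cQ _ FG FQ) FG).
- apply: le_trans (Hr r r0 (lexx _)); rewrite le_eqVlt; apply/orP; left.
  apply/eqP; congr (nrm _).
  by apply/funext => x; rewrite /= !fctE /GRing.scale/=; ring.
Qed.

Variable c : R.
Hypothesis c0 : 0 < c.
Hypothesis poincare : forall f g, is_generator mu Q f g -> L20 mu f ->
  c * nrm f ^+ 2 <= - ip f g.

(* One step of [d/dt |Q_t f|^2 = 2 <Q_t f, L Q_t f> <= - 2 c |Q_t f|^2], with an
   error that is uniform in [s] because [Q_s] is a contraction. *)
Let step f g e h s : is_generator mu Q f g -> L20 mu f -> 0 < h -> 0 <= s ->
  0 < e -> nrm (h^-1 *: (Q h f - f) - g) <= e ->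
  nrm (Q (h + s) f) ^+ 2 <= expR (- (2 * c) * h) * nrm (Q s f) ^+ 2 +
    h * (2 * e * nrm f + h * (nrm g + e) ^+ 2).
Proof.
move=> fg [Lf f0] h0 s0 e0 He; have h0' := ltW h0.
have [_ Lg _] := (is_generatorP cQ _ _).1 fg.
have Ls := semigroup_L2 cQ s0 Lf; have Lsg := semigroup_L2 cQ s0 Lg.
have Lhs := semigroup_L2 cQ h0' Ls; have hs0 := addr_ge0 h0' s0.
have Lh := semigroup_L2 cQ h0' Lf; have Lsh := semigroup_L2 cQ s0 Lh.
rewrite (nrm_eq_trans (semigroup_L2 cQ hs0 Lf) Lhs); last exact: semigroup_nrm_add.
set G := Q s f in Ls Lhs *; set G' := Q s g in Lsg *.
have LD := L2_B Lhs Ls.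
have -> : nrm (Q h G) ^+ 2 = nrm G ^+ 2 + 2 * ip G (Q h G - G) + nrm (Q h G - G) ^+ 2.
  transitivity (nrm (G + (Q h G - G)) ^+ 2); first by rewrite addrC subrK.
  rewrite !nrm2 (ip_Dl Ls LD (L2_D Ls LD)) (ip_Dr Ls LD Ls) (ip_Dr Ls LD LD).
  by rewrite (ipC _ (Q h G - G) G); lra.
have d1 : nrm (Q h G - G) <= h * (nrm g + e).
  apply: (@le_trans _ _ (nrm (Q h f - f))).
    have := nrm_tri Lhs Lsh Ls; rewrite semigroup_nrm_comm// add0r => /le_trans; apply.
    exact: semigroup_dist.
  have LB := L2_Z h^-1 (L2_B Lh Lf).
  rewrite -[Q h f - f](@scalerK _ _ h^-1) ?invr_eq0 ?gt_eqF// invrK nrmZ//.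
  rewrite gtr0_norm// ler_wpM2l//.
  rewrite -(subrK g (_ *: _)) (le_trans (nrm_triangle _ Lg))//; first exact: L2_B.
  by rewrite addrC lerD2l.
have d2 : ip G (Q h G - G) <= - h * c * nrm G ^+ 2 + h * (e * nrm f).
  have LX := L2_Z h^-1 LD.
  have -> : ip G (Q h G - G) = h * ip G G' + h * ip G (h^-1 *: (Q h G - G) - G').
    rewrite (ip_Br LX Lsg Ls) (ip_Zr _ LD Ls); field; exact/lt0r_neq0.
  have LG20 : L20 mu G by apply: (markov_L20 mQ).
  have := poincare (is_generator_semigroup cQ s0 fg) LG20; rewrite -/G -/G' => p.
  apply: lerD; first by have := ler_wpM2l h0' p; lra.
  rewrite ler_wpM2l//; apply: le_trans (ler_norm _) _.
  apply: le_trans (ip_CS Ls (L2_B LX Lsg)) _; rewrite mulrC.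
  apply: ler_pM; rewrite ?nrm_ge0//; last exact: semigroup_nrm_le.
  apply: le_trans He; exact: semigroup_quotient_le.
have d3 : nrm (Q h G - G) ^+ 2 <= (h * (nrm g + e)) ^+ 2.
  by rewrite ler_pXn2r// nnegrE ?nrm_ge0// mulr_ge0// addr_ge0 ?nrm_ge0// ltW.
have d4 : (1 - 2 * c * h) * nrm G ^+ 2 <= expR (- (2 * c) * h) * nrm G ^+ 2.
  by rewrite ler_wpM2r ?sqr_ge0// (le_trans _ (expR_ge1Dx _))// mulNr.
rewrite exprMn in d3.
apply: le_trans (_ : (1 - 2 * c * h) * nrm G ^+ 2 + h * (2 * e * nrm f + h * (nrm g + e) ^+ 2) <= _).
  by lra.
by rewrite lerD2r.
Qed.

(** A discrete Gronwall argument with n steps of length t / n: the decay factors multiply to the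
    exact exponential, and the errors add up to [t * dl]. The constants [A] and [B] bound each of
    the two parts of this error by eta / 2. *)
Let decay_Dom f g t : is_generator mu Q f g -> L20 mu f -> 0 <= t ->
  nrm (Q t f) <= expR (- c * t) * nrm f.
Proof.
move=> fg Lf; rewrite le_eqVlt => /predU1P[<-|t0].
  by rewrite mulr0 expR0 mul1r; apply: (semigroup_nrm_le cQ) => //; case: Lf.
have [Lf2 Lg Fr] := (is_generatorP cQ _ _).1 fg.
rewrite -(@ler_pXn2r _ 2)// ?nnegrE ?mulr_ge0 ?nrm_ge0 ?expR_ge0//.
apply/ler_addgt0Pr => eta eta0.
pose A := 4 * t * (nrm f + 1); have f0 := nrm_ge0 mu f; have g0 := nrm_ge0 mu g.
have f1 : 0 < nrm f + 1 by rewrite ltr_wpDl.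
have A0 : 0 < A by rewrite /A !mulr_gt0.
pose e := eta / A; have e0 : 0 < e by rewrite divr_gt0.
have [r r0 Hr] := Fr _ e0.
pose B := 2 * t * ((nrm g + e) ^+ 2 + 1).
have s0 := sqr_ge0 (nrm g + e).
have s1 : 0 < (nrm g + e) ^+ 2 + 1 by rewrite ltr_wpDl.
have B0 : 0 < B by rewrite /B !mulr_gt0.
pose rho := Num.min r (eta / B); have rho0 : 0 < rho by rewrite lt_min r0 divr_gt0.
pose n := (Num.truncn (t / rho)).+1.
have n0 : 0 < n%:R :> R by rewrite ltr0n.
pose h := t / n%:R; have h0 : 0 < h by rewrite divr_gt0.
have hrho : h <= rho.
  rewrite /h ler_pdivrMr// mulrC -ler_pdivrMr// ltW//.
  have /andP[_ //] := truncn_itv (ltW (divr_gt0 t0 rho0)).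
have [hr hB] : h <= r /\ h <= eta / B.
  by move: hrho; rewrite le_min => /andP[].
pose dl := 2 * e * nrm f + h * (nrm g + e) ^+ 2.
have [e0' h0'] : 0 <= e /\ 0 <= h by split; exact: ltW.
have dl0 : 0 <= dl by apply: addr_ge0; apply: mulr_ge0 => //; exact: mulr_ge0.
have iter k : nrm (Q (k%:R * h) f) ^+ 2 <=
    expR (- (2 * c) * (k%:R * h)) * nrm f ^+ 2 + k%:R * (h * dl).
  elim: k => [|k IH].
    rewrite !mul0r mulr0 expR0 mul1r addr0 ler_pXn2r ?nnegrE ?nrm_ge0//.
    exact: semigroup_nrm_le.
  have kh0 : 0 <= k%:R * h by rewrite mulr_ge0// ltW.
  have kdl0 : 0 <= k%:R * (h * dl) by rewrite mulr_ge0// mulr_ge0.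
  have -> : k.+1%:R * h = h + k%:R * h by rewrite -natr1; ring.
  have -> : k.+1%:R * (h * dl) = k%:R * (h * dl) + h * dl by rewrite -natr1; ring.
  apply: le_trans (step fg Lf h0 kh0 e0 (Hr _ h0 hr)) _.
  rewrite addrA -/dl lerD2r mulrDr expRD -mulrA.
  have E1 : expR (- (2 * c) * h) <= 1.
    by rewrite -expR0 ler_expR !mulNr oppr_le0 mulr_ge0// mulr_ge0// ltW.
  have E0 := expR_ge0 (- (2 * c) * h).
  by apply: le_trans (ler_wpM2l E0 IH) _; rewrite mulrDr lerD2l ler_piMl.
have := iter n; have -> : n%:R * h = t by rewrite /h mulrC divfK// gt_eqF.
move=> /le_trans; apply; apply: lerD.
  rewrite exprMn -expRM_natr le_eqVlt; apply/orP; left; apply/eqP.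
  by congr (expR _ * _); ring.
have -> : n%:R * (h * dl) = t * dl by rewrite mulrA [n%:R * h]mulrC /h divfK// gt_eqF.
have h1 : t * (2 * e * nrm f) <= eta / 2.
  rewrite /e /A.
  have -> : t * (2 * (eta / (4 * t * (nrm f + 1))) * nrm f) =
     eta / 2 * (nrm f / (nrm f + 1)) by field; rewrite !gt_eqF.
  by rewrite ler_piMr ?ler_pdivrMr// ?mul1r ?lerDl// divr_ge0// ltW.
have h2 : t * (h * (nrm g + e) ^+ 2) <= eta / 2.
  apply: le_trans (_ : t * (eta / B * (nrm g + e) ^+ 2) <= _).
    by rewrite ler_wpM2l ?(ltW t0)// ler_wpM2r.
  rewrite /B; set u := (nrm g + e) ^+ 2 in s0 *.
  have -> : t * (eta / (2 * t * (u + 1)) * u) = eta / 2 * (u / (u + 1)) by field; rewrite !gt_eqF.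
  by rewrite ler_piMr ?ler_pdivrMr// ?mul1r ?lerDl// divr_ge0// ltW.
rewrite /dl mulrDr; lra.
Qed.

(** Both sides are continuous in f for [nrm], so the bound passes from the dense domain to all
    mean-zero functions. *)
Lemma poincare_decay t f : 0 <= t -> L20 mu f ->
  nrm (Q t f) <= expR (- c * t) * nrm f.
Proof.
move=> t0 Lf; apply/ler_addgt0Pr => e e0.
have e2 : 0 < e / 2 by lra.
have [f' [g' [Lf' fg' ff']]] := Dom_dense Lf e2.
have := nrm_triangle (L2_B (semigroup_L2 cQ t0 Lf.1) (semigroup_L2 cQ t0 Lf'.1))
  (semigroup_L2 cQ t0 Lf'.1).
rewrite subrK => /le_trans; apply.
have E1 : expR (- c * t) <= 1.
  by rewrite -expR0 ler_expR mulNr oppr_le0 mulr_ge0// ltW.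
have E0 := expR_ge0 (- c * t).
have h1 := le_trans (semigroup_dist cQ t0 Lf.1 Lf'.1) ff'.
have h2 := decay_Dom fg' Lf' t0.
have h3 : nrm f' <= nrm f + e / 2.
  have := nrm_triangle (L2_B Lf'.1 Lf.1) Lf.1; rewrite subrK nrm_distC; lra.
have h4 := ler_wpM2l E0 h3.
have h5 : expR (- c * t) * (e / 2) <= e / 2 by rewrite ler_piMl// ltW.
lra.
Qed.

Lemma relaxation_time_le : (relaxation_time mu Q <= (c^-1)%:E)%E.
Proof.
apply: ereal_inf_lbound; exists c^-1 => //; split; first by rewrite invr_ge0 ltW.
have ci0 : 0 <= c^-1 by rewrite invr_ge0 ltW.
move=> f Lf; rewrite !L2normE//; [|exact: Lf.1|exact: (semigroup_L2 cQ) Lf.1].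
rewrite -EFinM lee_fin; have := poincare_decay ci0 Lf.
by rewrite mulNr mulfV ?gt_eqF.
Qed.

(** The real part of <F, (- L - alpha) F> is at least (c - a) |F|^2 for F = f1 + i f2, because the
    two cross terms [b * ip f1 f2] cancel. Cauchy-Schwarz in each component and 2 x y <= x^2 + y^2
    then give the squared form, with no division by a norm that may vanish. *)
Let coercive a b f1 f2 g1 g2 : a < c -> is_generator mu Q f1 g1 ->
  is_generator mu Q f2 g2 -> L20 mu f1 -> L20 mu f2 ->
  (c - a) ^+ 2 * (nrm f1 ^+ 2 + nrm f2 ^+ 2) <=
    nrm (- g1 - (a *: f1 - b *: f2)) ^+ 2 + nrm (- g2 - (b *: f1 + a *: f2)) ^+ 2.
Proof.
move=> ac fg1 fg2 Lf1 Lf2.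
have p1 := poincare fg1 Lf1; have p2 := poincare fg2 Lf2.
have [{}Lf1 Lg1 _] := (is_generatorP cQ _ _).1 fg1.
have [{}Lf2 Lg2 _] := (is_generatorP cQ _ _).1 fg2.
set h1 := - g1 - _; set h2 := - g2 - _.
have LN f : L2 mu f -> L2 mu (- f) by move=> Lf; rewrite -scaleN1r; exact: L2_Z.
have ipN f g : L2 mu f -> L2 mu g -> ip f (- g) = - ip f g.
  by move=> ? ?; rewrite -scaleN1r ip_Zr// mulN1r.
have La1 := L2_Z a Lf1; have Lb2 := L2_Z b Lf2.
have La2 := L2_Z a Lf2; have Lb1 := L2_Z b Lf1.
have Lh1 : L2 mu h1 by apply: L2_B; [exact: LN|exact: L2_B].
have Lh2 : L2 mu h2 by apply: L2_B; [exact: LN|exact: L2_D].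
have e1 : ip f1 h1 = - ip f1 g1 - a * nrm f1 ^+ 2 + b * ip f1 f2.
  rewrite nrm2 ip_Br// ?ipN// ?ip_Br// ?ip_Zr//; [lra|exact: LN|exact: L2_B].
have e2 : ip f2 h2 = - ip f2 g2 - a * nrm f2 ^+ 2 - b * ip f1 f2.
  rewrite nrm2 ip_Br// ?ipN// ?ip_Dr// ?ip_Zr// ?(ipC _ f2 f1);
   [lra|exact: LN|exact: L2_D].
have := le_trans (ler_norm _) (ip_CS Lf1 Lh1); rewrite e1 => q1.
have := le_trans (ler_norm _) (ip_CS Lf2 Lh2); rewrite e2 => q2.
have k0 : 0 < c - a by rewrite subr_gt0.
have q : (c - a) * (nrm f1 ^+ 2 + nrm f2 ^+ 2) <= nrm f1 * nrm h1 + nrm f2 * nrm h2.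
  lra.
have s1 := sqr_ge0 ((c - a) * nrm f1 - nrm h1).
have s2 := sqr_ge0 ((c - a) * nrm f2 - nrm h2).
have q' := ler_wpM2l (ltW k0) q.
lra.
Qed.

Let L2_normc f1 f2 : L2 mu f1 -> L2 mu f2 ->
  L2normC mu (fun x => (f1 x +i* f2 x)%C) =
    (Num.sqrt (nrm f1 ^+ 2 + nrm f2 ^+ 2))%:E.
Proof.
move=> L1 L2.
have m1 := L2_measurable L1; have m2 := L2_measurable L2.
set u := fun x => Normc.normc (f1 x +i* f2 x)%C.
have u2 x : u x ^+ 2 = f1 x * f1 x + f2 x * f2 x.
  by rewrite /u /= sqr_sqrtr ?addr_ge0 ?sqr_ge0.
have mu_ : measurable_fun setT u.
  rewrite (_ : u = Num.sqrt \o (fun x => f1 x ^+ 2 + f2 x ^+ 2))//.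
  apply: measurableT_comp.
    by apply: continuous_measurable_fun; exact: sqrt_continuous.
  by apply: measurable_funD; exact: measurable_funX.
have S0 : 0 <= nrm f1 ^+ 2 + nrm f2 ^+ 2 by rewrite addr_ge0 ?sqr_ge0.
have I1 := L2_mul_integrable L1 L1; have I2 := L2_mul_integrable L2 L2.
have iu : \int[mu]_x (u x ^+ 2) = nrm f1 ^+ 2 + nrm f2 ^+ 2.
  rewrite !nrm2 /ip -RintegralD//.
  by apply: eq_Rintegral => x _; rewrite u2.
have Lu : Defs.L2 mu u.
  apply: (L2_of_integral_sqr mu_ (sqrtr_ge0 (nrm f1 ^+ 2 + nrm f2 ^+ 2)) _).1.
  rewrite sqr_sqrtr// -iu /Rintegral fineK//.
  apply: integrable_fin_num => //.
  have := integrableD measurableT I1 I2.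
  by congr (_.-integrable _ _); apply/funext => x /=; rewrite u2.
rewrite /L2normC -/u L2normE// /nrm; congr (Num.sqrt _)%:E.
by rewrite -iu; apply: eq_Rintegral => x _; rewrite expr2.
Qed.

Let shifted_genE a b F : shifted_gen mu Q (a +i* b)%C F = fun x =>
  let G1 := gen mu Q (fun y => complex.Re (F y)) in
  let G2 := gen mu Q (fun y => complex.Im (F y)) in
  ((- G1 x - (a * complex.Re (F x) - b * complex.Im (F x))) +i*
   (- G2 x - (b * complex.Re (F x) + a * complex.Im (F x))))%C.
Proof.
apply/funext => x; rewrite /shifted_gen /genC; case: (F x) => u v /=.
by congr (_ +i* _)%C; ring.
Qed.

(** Every alpha with real part below c lies in the resolvent set: [coercive] gives injectivity and
    the bound (c - a)^-1 on the inverse, [resolvent_pair] gives surjectivity. *)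
Lemma poincare_gap : (c%:E <= gap mu Q)%E.
Proof.
apply: le_ereal_inf_tmp => _ [[a b] /= spec <-]; rewrite lee_fin leNgt.
apply/negP => ac; apply: spec.
have ca0 : 0 < c - a by rewrite subr_gt0.
have DomG f : Dom mu Q f -> is_generator mu Q f (gen mu Q f).
  by move=> [g /(is_generator_gen cQ)[]].
have LN f : L2 mu f -> L2 mu (- f) by move=> Lf; rewrite -scaleN1r; exact: L2_Z.
have Lsh x y f1 f2 g : L2 mu f1 -> L2 mu f2 -> L2 mu g ->
    L2 mu (- g - (x *: f1 - y *: f2)) /\ L2 mu (- g - (x *: f1 + y *: f2)).
  by move=> L1 L2 Lg; split; apply: L2_B; [exact: LN|apply: L2_B; exact: L2_Z
    |exact: LN|apply: L2_D; exact: L2_Z].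
split.
- move=> F G [[DF1 LF1] [DF2 LF2]] [[DG1 LG1] [DG2 LG2]].
  rewrite !shifted_genE /= => FG.
  have gF1 := DomG _ DF1; have gF2 := DomG _ DF2.
  have gG1 := DomG _ DG1; have gG2 := DomG _ DG2.
  have g1 := is_generator_lin cQ (-1) gG1 gF1.
  have g2 := is_generator_lin cQ (-1) gG2 gF2.
  have L1 := L20_lin (-1) LG1 LF1; have L2 := L20_lin (-1) LG2 LF2.
  have := coercive b ac g1 g2 L1 L2.
  set f1 := -1 *: _ + _ in g1 L1 *; set f2 := -1 *: _ + _ in g2 L2 *.
  set h1 := - _ - _; set h2 := - _ - _.
  have [_ Lg1 _] := (is_generatorP cQ _ _).1 g1.
  have [_ Lg2 _] := (is_generatorP cQ _ _).1 g2.
  have -> : nrm h1 = 0.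
    apply/(nrm_eq0 (Lsh a b _ _ _ L1.1 L2.1 Lg1).1).
    apply: filterS FG => x /(_ I) [] /eqP; rewrite -subr_eq0 => /eqP E _ _.
    rewrite -[RHS]E /h1 /f1 /f2 /= !fctE /GRing.scale/=; ring.
  have -> : nrm h2 = 0.
    apply/(nrm_eq0 (Lsh b a _ _ _ L1.1 L2.1 Lg2).2).
    apply: filterS FG => x /(_ I) [] _ /eqP; rewrite -subr_eq0 => /eqP E _.
    rewrite -[RHS]E /h2 /f1 /f2 /= !fctE /GRing.scale/=; ring.
  rewrite expr0n/= addr0 pmulr_rle0 ?exprn_gt0// => le0.
  have n1 := sqr_ge0 (nrm f1); have n2 := sqr_ge0 (nrm f2).
  have /eqP : nrm f1 ^+ 2 = 0 by lra.
  have /eqP : nrm f2 ^+ 2 = 0 by lra.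
  rewrite !sqrf_eq0 => /eqP/(nrm_eq0 L2.1) E2 /eqP/(nrm_eq0 L1.1) E1.
  apply: filterS2 E1 E2 => x /(_ I) E1 /(_ I) E2 _.
  move: E1 E2; rewrite /f1 /f2 /= !fctE /GRing.scale/=.
  case: (F x) => x1 x2; case: (G x) => y1 y2 /= E1 E2.
  have {}E1 : -1 * y1 + x1 = 0 := E1; have {}E2 : -1 * y2 + x2 = 0 := E2.
  by congr (_ +i* _)%C; lra.
- move=> H [LH1 LH2].
  have [F1 [F2 [LF1 LF2 G1 G2]]] := resolvent_pair mQ b poincare_decay ac LH1 LH2.
  exists (fun x => (F1 x +i* F2 x)%C).
    by split; split => //; eexists; [exact: G1|exact: G2].
  rewrite shifted_genE /=.
  (* The solution comes with its own generator images, whereas [shifted_gen] uses the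
     representatives chosen by [gen]; they agree almost everywhere. *)
  have [gG1 e1] := is_generator_gen cQ G1.
  have [gG2 e2] := is_generator_gen cQ G2.
  have [_ Lg1 _] := (is_generatorP cQ _ _).1 gG1.
  have [_ Lg2 _] := (is_generatorP cQ _ _).1 gG2.
  have [_ Lg1' _] := (is_generatorP cQ _ _).1 G1.
  have [_ Lg2' _] := (is_generatorP cQ _ _).1 G2.
  have E1 := nrm_ae_eq Lg1 Lg1' e1; have E2 := nrm_ae_eq Lg2 Lg2' e2.
  apply: filterS2 E1 E2 => x /(_ I) E1 /(_ I) E2 _.
  rewrite -[F1]/(fun y => F1 y) -[F2]/(fun y => F2 y) in E1 E2.
  rewrite E1 E2 /= !fctE /GRing.scale/=; case: (H x) => u v /=.
  by congr (_ +i* _)%C; ring.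
- exists (c - a)^-1 => F [[DF1 LF1] [DF2 LF2]].
  have gF1 := DomG _ DF1; have gF2 := DomG _ DF2.
  have := coercive b ac gF1 gF2 LF1 LF2.
  have [_ Lg1 _] := (is_generatorP cQ _ _).1 gF1.
  have [_ Lg2 _] := (is_generatorP cQ _ _).1 gF2.
  rewrite shifted_genE.
  set f1 := (fun x => complex.Re (F x)) in gF1 LF1 Lg1 *.
  set f2 := (fun x => complex.Im (F x)) in gF2 LF2 Lg2 *.
  have FE : F = fun x => (f1 x +i* f2 x)%C.
    by apply/funext => x; rewrite /f1 /f2; case: (F x).
  have l1 := (Lsh a b _ _ _ LF1.1 LF2.1 Lg1).1.
  have l2 := (Lsh b a _ _ _ LF1.1 LF2.1 Lg2).2.
  move=> co; rewrite [in leLHS]FE L2_normc ?LF1.1 ?LF2.1//; last 2 first.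
  + exact: LF1.1.
  + exact: LF2.1.
  have -> : L2normC mu (fun x => ((- gen mu Q f1 x - (a * f1 x - b * f2 x)) +i*
      (- gen mu Q f2 x - (b * f1 x + a * f2 x)))%C) = _ := L2_normc l1 l2.
  rewrite -EFinM lee_fin mulrC ler_pdivlMr//.
  rewrite -(ger0_norm (ltW ca0)) -sqrtr_sqr mulrC -sqrtrM ?sqr_ge0//.
  exact: ler_wsqrtr.
Qed.

End poincare.

(** * From delayed or averaged decay to a bound on the inverse of the generator *)

(** Right endpoints yield a lower sum since u is nonincreasing; monotonicity also provides the
    measurability of u. *)
Lemma riemann_sum_le_integral (R : realType) (u : R -> R) (t h : R) (m : nat) :
  (forall s, 0 <= u s) -> {homo u : x y /~ y <= x} -> 0 <= h ->
  ((h * \sum_(0 <= i < m) u (t + i.+1%:R * h))%:E <=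
    \int[lebesgue_measure]_(s in `[t, (t + m%:R * h)%R]) (u s)%:E)%E.
Proof.
move=> u0 ud h0; elim: m => [|m IH].
  by rewrite big_geq// mulr0 integral_ge0// => s _; rewrite lee_fin.
rewrite big_nat_recr//= mulrDr EFinD.
have mu_ (D : set R) : measurable D -> measurable_fun D (EFin \o u).
  by move=> mD; apply/measurable_EFinP; exact: nonincreasing_measurable.
have th : t + m%:R * h <= t + m.+1%:R * h.
  by rewrite lerD2l ler_wpM2r// ler_nat.
have tm : t <= t + m%:R * h by rewrite lerDl mulr_ge0.
have -> : [set` `[t, t + m.+1%:R * h]] =
    [set` `[t, t + m%:R * h]] `|` [set` `]t + m%:R * h, t + m.+1%:R * h]].
  by rewrite -itv_bndbnd_setU//= bnd_simp.
rewrite ge0_integral_setU//=.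
- apply: leeD => //.
  set a := t + m%:R * h in th *; set b := t + m.+1%:R * h in th *.
  have ab : b - a = h by rewrite /a /b -natr1; ring.
  apply: (@le_trans _ _ (\int[lebesgue_measure]_(s in `]a, b]) (u b)%:E)%E).
    rewrite integral_cst//= lebesgue_measure_itv/= lte_fin.
    case: ltP => [_|hm].
      by rewrite -EFinB ab -EFinM mulrC.
    have -> : h = 0 by apply/le_anti; rewrite h0 andbT -ab; lra.
    by rewrite mul0r mule0.
  apply: ge0_le_integral => //=.
  + by move=> s _; rewrite lee_fin.
  + exact: mu_.
  + by move=> s; rewrite in_itv/= lee_fin => /andP[_ st]; exact: ud.
- by apply: mu_; exact: measurableU.
- by move=> s _; rewrite lee_fin.
- apply/disj_setPS => s [] /=; rewrite !in_itv/= => /andP[_ s1] /andP[s2 _].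
  by move: (lt_le_trans s2 s1); rewrite ltxx.
Qed.

(** Replacing the sum by its shift by i + 1 costs at most the i + 1 dropped terms, each bounded by
    [x 0]. Summed over the m shifts, the cost is 1 + ... + m times [x 0]. *)
Lemma sum_shift_le (R : realType) (x : nat -> R) (m n : nat) :
  (forall k, 0 <= x k) -> (forall k, x k <= x 0%N) ->
  m%:R * \sum_(0 <= k < n) x k <=
    \sum_(0 <= j < n) \sum_(0 <= i < m) x (j + i.+1)%N +
      m%:R * (m%:R + 1) / 2 * x 0%N.
Proof.
move=> x0 xm; have one i : \sum_(0 <= k < n) x k <=
    \sum_(0 <= j < n) x (j + i.+1)%N + i.+1%:R * x 0%N.
  apply: (@le_trans _ _ (\sum_(0 <= k < n + i.+1) x k)).
    by rewrite [leRHS](@big_cat_nat _ _ _ n)//= ?leq_addr// lerDl sumr_ge0.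
  rewrite (@big_cat_nat _ _ _ i.+1)//= ?leq_addl// addrC; apply: lerD.
    by rewrite -{1}[i.+1]add0n big_addn addnK.
  apply: le_trans (_ : \sum_(0 <= k < i.+1) x 0%N <= _); first exact: ler_sum.
  by rewrite big_const_nat iter_addr addr0 subn0 mulr_natl.
elim: m => [|m IH].
  by rewrite !mul0r addr0 sumr_ge0// => j _; rewrite big_geq.
rewrite -natr1 mulrDl mul1r.
have -> : \sum_(0 <= j < n) \sum_(0 <= i < m.+1) x (j + i.+1)%N =
    \sum_(0 <= j < n) (\sum_(0 <= i < m) x (j + i.+1)%N + x (j + m.+1)%N).
  by apply: eq_bigr => j _; rewrite big_nat_recr.
rewrite big_split/=; have := one m; rewrite -natr1; lra.
Qed.

Section summable_decay.
Context (d : measure_display) (T : measurableType d) (R : realType).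
Variables (mu : probability T R) (Q : R -> (T -> R) -> (T -> R)).
Hypothesis mQ : markov_semigroup mu Q.
Implicit Types (f g : T -> R) (e h s t K S nu : R).
Local Notation nrm := (nrm mu).
Let cQ : contraction_semigroup mu Q := mQ.1.

Lemma semigroup_nrm_homo s t f : 0 <= s -> s <= t -> L2 mu f ->
  nrm (Q t f) <= nrm (Q s f).
Proof.
move=> s0 st Lf; have ts0 : 0 <= t - s by rewrite subr_ge0.
have Ls := semigroup_L2 cQ s0 Lf.
rewrite (nrm_eq_trans _ (semigroup_L2 cQ ts0 Ls)).
- exact: semigroup_nrm_le.
- by apply: (semigroup_L2 cQ) => //; exact: le_trans st.
- by rewrite -{1}(subrK s t); exact: semigroup_nrm_add.
Qed.

(** The triangle inequality in a telescoping sum that discretises f = Q_t f - int_0^t Q_s L f ds. *)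
Lemma nrm_telescope f h n : 0 <= h -> L2 mu f ->
  nrm f <= nrm (Q (n%:R * h) f) + \sum_(0 <= k < n) nrm (Q (k%:R * h) (f - Q h f)).
Proof.
move=> h0 Lf; have Lh := semigroup_L2 cQ h0 Lf.
have L0 k : 0 <= k%:R * h by rewrite mulr_ge0.
have Lk k := semigroup_L2 cQ (L0 k) Lf.
elim: n => [|n IH].
  rewrite mul0r big_geq// addr0.
  have L := semigroup_L2 cQ (lexx 0) Lf.
  by rewrite (nrm_eq_trans L Lf)//; apply: ae_eq_nrmB => //; exact: (semigroup0 cQ).
rewrite big_nat_recr//=.
suff : nrm (Q (n%:R * h) f) <=
  nrm (Q (n.+1%:R * h) f) + nrm (Q (n%:R * h) (f - Q h f)) by lra.
have Lu := semigroup_L2 cQ (L0 n) (L2_B Lf Lh).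
have Lnh := semigroup_L2 cQ (L0 n) Lh.
have e1 := semigroup_nrmB cQ (L0 n) Lf Lh.
have e2 := semigroup_nrm_add cQ (L0 n) h0 Lf.
have E : n.+1%:R * h = n%:R * h + h by rewrite -natr1; ring.
rewrite -E in e2.
have LB := L2_B (Lk n) Lnh.
have := nrm_triangle LB Lnh; rewrite subrK.
rewrite -(nrm_eq_trans Lu LB e1) -(nrm_eq_trans (Lk n.+1) Lnh e2).
by rewrite addrC.
Qed.

(* The sums in the hypothesis approximate [int_0^oo |Q_s v| ds <= K |v|]; they
   are applied to [f - Q_h f], which is close to [- h g], and to [f] itself to
   get [Q_(n h) f --> 0]. *)
Lemma generator_bound K S f g : 0 <= K -> 0 < S ->
  (forall v, L20 mu v -> forall m n : nat, (0 < m)%N ->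
    S / m%:R * \sum_(0 <= k < n) nrm (Q (k%:R * (S / m%:R)) v) <=
      (K + 2 * (S / m%:R)) * nrm v) ->
  is_generator mu Q f g -> L20 mu f -> nrm f <= K * nrm g.
Proof.
move=> K0 S0 bound fg Lf.
have [Lf2 Lg Fr] := (is_generatorP cQ _ _).1 fg.
have g0 := nrm_ge0 mu g; have f0 := nrm_ge0 mu f.
suff main e : 0 < e -> e <= 1 -> nrm f <= e + (K + 2 * e) * (nrm g + e).
  apply/ler_addgt0Pr => eta eta0.
  (* The excess of the right-hand side of [main] over [K * nrm g] is e (1 + K + 2 |g| + 2 e), which
     is at most [e * B] when e <= 1. *)
  pose B := K + 2 * nrm g + 3; have B0 : 0 < B by rewrite /B; lra.
  pose e := Num.min 1 (eta / B).
  have e0 : 0 < e by rewrite lt_min ltr01 divr_gt0.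
  have [e1 eB] : e <= 1 /\ e <= eta / B.
    by split; rewrite /e ge_min lexx ?orbT.
  apply: le_trans (main _ e0 e1) _.
  move: eB; rewrite ler_pdivlMr// /B => eB.
  have ee : e * e <= e by rewrite ler_piMr// ltW.
  lra.
move=> e0 e1.
have [r r0 Hr] := Fr _ e0.
pose rho := Num.min r e; have rho0 : 0 < rho by rewrite lt_min r0.
pose m := (Num.truncn (S / rho)).+1.
have m0 : 0 < m%:R :> R by rewrite ltr0n.
pose h := S / m%:R; have h0 : 0 < h by rewrite divr_gt0.
have hrho : h <= rho.
  rewrite /h ler_pdivrMr// mulrC -ler_pdivrMr// ltW//.
  by have /andP[_] := truncn_itv (ltW (divr_gt0 S0 rho0)).
have [hr he] : h <= r /\ h <= e by move: hrho; rewrite le_min => /andP[].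
have h0' := ltW h0.
have Qf := markov_L20 mQ h0' Lf.
have Lu : L20 mu (f - Q h f) by exact: L20_B.
have Kh0 : 0 <= K + 2 * h by rewrite addr_ge0// mulr_ge0.
(* The norms along the orbit are nonincreasing, so n times the last one is at most the sum bounded
   by hypothesis; this n forces that norm below e. *)
pose n := (Num.truncn ((K + 2 * h) * nrm f / (h * e))).+1.
have n0 : 0 < n%:R :> R by rewrite ltr0n.
have he0 : 0 < h * e by exact: mulr_gt0.
have tail : nrm (Q (n%:R * h) f) <= e.
  have := bound f Lf m n (ltn0Sn _); rewrite -/h => b1.
  have : n%:R * (h * nrm (Q (n%:R * h) f)) <= (K + 2 * h) * nrm f.
    apply: le_trans b1; rewrite mulrCA ler_wpM2l//.
    have -> : n%:R * nrm (Q (n%:R * h) f) = \sum_(0 <= k < n) nrm (Q (n%:R * h) f).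
      by rewrite big_const_nat iter_addr addr0 subn0 mulr_natl.
    rewrite big_nat [leRHS]big_nat; apply: ler_sum => k /andP[_ kn].
    apply: semigroup_nrm_homo => //; first by rewrite mulr_ge0.
    by rewrite ler_wpM2r// ler_nat ltnW.
  have : (K + 2 * h) * nrm f <= n%:R * (h * e).
    rewrite -ler_pdivrMr//; apply: ltW.
    have nn : 0 <= (K + 2 * h) * nrm f / (h * e).
      by rewrite divr_ge0// ?mulr_ge0// ltW.
    by have /andP[_] := truncn_itv nn.
  move=> /[swap] /le_trans /[apply].
  by rewrite ler_pM2l// ler_pM2l.
have u_le : nrm (f - Q h f) <= h * (nrm g + e).
  have LX : L2 mu (h^-1 *: (Q h f - f)) by apply: L2_Z; exact: L2_B Qf.1 Lf2.
  rewrite nrm_distC -[Q h f - f](@scalerK _ _ h^-1) ?invr_eq0 ?gt_eqF// invrK nrmZ//.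
  rewrite gtr0_norm// ler_wpM2l//.
  rewrite -(subrK g (_ *: _)) (le_trans (nrm_triangle (L2_B LX Lg) Lg))//.
  by rewrite addrC lerD2l; exact: Hr.
apply: le_trans (nrm_telescope n h0' Lf2) _; apply: lerD => //.
have := bound _ Lu m n (ltn0Sn _); rewrite -/h => b2.
rewrite -(ler_pM2l h0); apply: le_trans b2 _.
apply: le_trans (_ : (K + 2 * h) * (h * (nrm g + e)) <= _).
  by rewrite ler_wpM2l.
rewrite mulrCA ler_wpM2l// ler_wpM2r//; first by rewrite addr_ge0// ltW.
by rewrite lerD2l ler_wpM2l.
Qed.

(** Contraction alone contributes S up to time S, and the exponential contributes 1 / nu beyond. A
    mesh of the form S / m puts the delay S exactly on the grid. *)
Lemma delayed_generator_bound S nu f g : 0 < S -> 0 < nu ->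
  delayed_contractive mu Q S nu ->
  is_generator mu Q f g -> L20 mu f -> nrm f <= (nu^-1 + S) * nrm g.
Proof.
move=> S0 nu0 dQ; have nui : 0 <= nu^-1 by rewrite invr_ge0 ltW.
apply: (generator_bound _ S0); first by rewrite addr_ge0// ltW.
move=> v Lv m n m0; set h := S / m%:R.
have mr0 : 0 < m%:R :> R by rewrite ltr0n.
have h0 : 0 < h by rewrite divr_gt0.
have hm : m%:R * h = S by rewrite /h mulrC divfK// gt_eqF.
have v0 := nrm_ge0 mu v; have h0' := ltW h0.
have kh0 (k : nat) : 0 <= k%:R * h by rewrite mulr_ge0.
(* Adding m terms makes the splitting at index m, that is at time S, legitimate even when n < m. *)
apply: (@le_trans _ _ (h * \sum_(0 <= k < m + n) nrm (Q (k%:R * h) v))).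
  rewrite ler_wpM2l// [leRHS](@big_cat_nat _ _ _ n)//= ?leq_addl//.
  by rewrite lerDl sumr_ge0// => k _; exact: nrm_ge0.
rewrite (@big_cat_nat _ _ _ m _ (m + n))//= ?leq_addr// mulrDr.
have h1 : h * \sum_(0 <= k < m) nrm (Q (k%:R * h) v) <= S * nrm v.
  rewrite -hm [m%:R * h]mulrC -[leRHS]mulrA ler_wpM2l//.
  have -> : m%:R * nrm v = \sum_(0 <= k < m) nrm v.
    by rewrite big_const_nat iter_addr addr0 subn0 mulr_natl.
  by apply: ler_sum => k _; apply: (semigroup_nrm_le cQ) => //; exact: Lv.1.
have h2 : h * \sum_(m <= k < m + n) nrm (Q (k%:R * h) v) <= (nu^-1 + h) * nrm v.
  apply: (@le_trans _ _ (h * \sum_(m <= k < m + n)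
     expR (- nu * (k%:R * h)) * (expR (nu * S) * nrm v))).
    rewrite ler_wpM2l//; apply: ler_sum => k _.
    have := dQ v Lv _ (kh0 k); rewrite !L2normE; last 2 first.
    - exact: Lv.1.
    - by apply: (semigroup_L2 cQ) => //; exact: Lv.1.
    rewrite -EFinM lee_fin (_ : - nu * _ = - nu * (k%:R * h) + nu * S); last by ring.
    by rewrite expRD -[leRHS]mulrA.
  rewrite -mulr_suml mulrA.
  have := sum_expR_le m (m + n) nu0 h0; rewrite hm => q.
  apply: le_trans (ler_wpM2r _ q) _; first by rewrite mulr_ge0// expR_ge0.
  rewrite mulNr expRN le_eqVlt; apply/orP; left; apply/eqP.
  by field; rewrite !gt_eqF// expR_gt0.
have hv0 := mulr_ge0 h0' v0.
lra.
Qed.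

(* Discretises [int_0^oo u = int_0^oo (1/2S) int_t^(t+2S) u ds dt +
   int_0^2S (1 - s/2S) u(s) ds] for [u s = |Q_s v|]. The first term is at most
   [u(0) / nu], the second one at most [S u(0)]. *)
Lemma average_generator_bound S nu f g : 0 < S -> 0 < nu ->
  average_contractive mu Q (2 * S) nu ->
  is_generator mu Q f g -> L20 mu f -> nrm f <= (nu^-1 + S) * nrm g.
Proof.
move=> S0 nu0 aQ; have nui : 0 <= nu^-1 by rewrite invr_ge0 ltW.
have S20 : 0 < 2 * S by exact: mulr_gt0.
apply: (generator_bound _ S20); first by rewrite addr_ge0// ltW.
move=> v Lv m n m0; set h := 2 * S / m%:R.
have mr0 : 0 < m%:R :> R by rewrite ltr0n.
have h0 : 0 < h by rewrite divr_gt0.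
have hm : m%:R * h = 2 * S by rewrite /h mulrC divfK// gt_eqF.
have v0 := nrm_ge0 mu v; have h0' := ltW h0.
have kh0 (k : nat) : 0 <= k%:R * h by rewrite mulr_ge0.
pose x k := nrm (Q (k%:R * h) v).
have avg j : h * \sum_(0 <= i < m) x (j + i.+1)%N <=
    2 * S * (expR (- nu * (j%:R * h)) * nrm v).
  (* Negative times carry no information on Q; freezing u there makes it nonincreasing on the whole
     line. *)
  pose u s := nrm (Q (Num.max s 0) v).
  have ud : {homo u : a b /~ b <= a}.
    move=> a b ab; apply: semigroup_nrm_homo; [by rewrite le_max lexx orbT| |exact: Lv.1].
    by rewrite ge_max !le_max lexx orbT ab.
  have := riemann_sum_le_integral (j%:R * h) m (fun s => nrm_ge0 mu _) ud h0'.
  have -> : \sum_(0 <= i < m) u (j%:R * h + i.+1%:R * h) =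
      \sum_(0 <= i < m) x (j + i.+1)%N.
    apply: eq_bigr => i _; rewrite /u /x natrD mulrDl max_l//.
    exact: addr_ge0.
  have := aQ v Lv _ (kh0 j); rewrite hm.
  have -> : (\int[lebesgue_measure]_(s in `[(j%:R * h)%R, (j%:R * h + 2 * S)%R])
       L2norm mu (Q s v) = \int[lebesgue_measure]_(s in `[(j%:R * h)%R, (j%:R * h + 2 * S)%R]) (u s)%:E)%E.
    apply: eq_integral => s; rewrite inE/= in_itv/= => /andP[js _].
    have s0 := le_trans (kh0 j) js.
    by rewrite /u max_l// L2normE//; apply: (semigroup_L2 cQ) => //; exact: Lv.1.
  rewrite L2normE; last exact: Lv.1.
  rewrite -EFinM => p q.
  have := le_trans (lee_wpmul2l _ q) p; rewrite lee_fin invr_ge0 => /(_ (ltW S20)).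
  by rewrite -EFinM lee_fin ler_pdivrMl.
have x0 k : 0 <= x k by exact: nrm_ge0.
have xm k : x k <= x 0%N.
  by apply: semigroup_nrm_homo; [|rewrite ler_wpM2r|exact: Lv.1].
have xv : x 0%N <= nrm v by apply: (semigroup_nrm_le cQ) => //; exact: Lv.1.
have comb := sum_shift_le m n x0 xm.
have total : h * (h * \sum_(0 <= j < n) \sum_(0 <= i < m) x (j + i.+1)%N) <=
    2 * S * ((nu^-1 + h) * nrm v).
  rewrite mulr_sumr.
  apply: (@le_trans _ _ (h * \sum_(0 <= j < n)
      2 * S * (expR (- nu * (j%:R * h)) * nrm v))).
    by rewrite ler_wpM2l//; apply: ler_sum => j _; exact: avg.
  rewrite -mulr_sumr -mulr_suml mulrCA [h * (_ * _)]mulrA.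
  have := sum_expR_le 0 n nu0 h0; rewrite mul0r mulr0 expR0 mul1r => q.
  by apply: (ler_wpM2l (ltW S20)); exact: ler_wpM2r.
rewrite -(ler_pM2l S20) -{1}hm.
have := ler_wpM2l (sqr_ge0 h) comb.
set A := \sum_(0 <= k < n) x k in comb *; set B := \sum_(0 <= j < n) _ in total comb *.
(* After division by m h = 2 S the boundary term contributes S + h / 2, and [total] contributes 1 /
   nu + h: together K + 3 h / 2 with K = 1 / nu + S, within the allowed K + 2 h. *)
have -> : h ^+ 2 * (B + m%:R * (m%:R + 1) / 2 * x 0%N) =
  h * (h * B) + (m%:R * h) * (m%:R * h + h) / 2 * x 0%N by ring.
have -> : h ^+ 2 * (m%:R * A) = m%:R * h * (h * A) by ring.
move=> /le_trans; apply; rewrite hm.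
have w0 : 0 <= 2 * S * (2 * S + h) / 2.
  by rewrite divr_ge0// mulr_ge0 ?addr_ge0// ltW.
have := ler_wpM2l w0 xv.
have z0 : 0 <= S * (h * nrm v) by rewrite mulr_ge0 ?mulr_ge0// ltW.
lra.
Qed.

End summable_decay.

(** * Functions of the first coordinate, and transfer of the bound through the lift *)

Section lift.
Context (R : realType) (d d' : measure_display).
Context (X : measurableType d) (V : measurableType d').
Variables (mu : probability X R) (kappa : R.-pker X ~> V).
Variable muh : probability (X * V)%type R.
Hypothesis disint : disintegrates muh mu kappa.
Implicit Types (f g : X -> R).

(** A section of the cylinder over A is everything or nothing, and [kappa x] has mass 1. Hence
    composition with the projection is an isometry of L^2 that preserves means. *)
Lemma marginal A : measurable A -> muh (fst @^-1` A) = mu A.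
Proof.
move=> mA; have mfA : measurable (@fst X V @^-1` A).
  by rewrite -[_ @^-1` _]setTI; exact: measurable_fst.
rewrite disint//; transitivity (\int[mu]_x (\1_A x)%:E)%E; last first.
  by rewrite integral_indic// setIT.
apply: eq_integral => x _; rewrite indicE; have [xA|xA] := boolP (x \in A).
  rewrite (_ : xsection _ _ = setT) ?prob_kernel//.
  by apply/seteqP; split => // y _; rewrite /xsection/= inE/=; exact: set_mem.
rewrite (_ : xsection _ _ = set0) ?measure0//.
by apply/seteqP; split => // y; rewrite /xsection/= inE/= => /mem_set; rewrite (negbTE xA).
Qed.

Let mfst : measurable_fun setT (@fst X V) := measurable_fst.

Let integral_fst (h : X -> \bar R) :
  (\int[pushforward muh (@fst X V)]_x h x = \int[mu]_x h x)%E.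
Proof. by apply: eq_measure_integral => A mA _; exact: marginal. Qed.

Lemma L2_fst f : L2 mu f -> L2 muh (f \o fst).
Proof.
move=> Lf; have mf := L2_measurable Lf.
apply: (@L2_of_integral_sqr _ _ _ muh _ (nrm mu f) _ (nrm_ge0 _ _) _).1.
  exact: measurableT_comp.
have mf2 : measurable_fun setT (fun x => (f x ^+ 2)%:E).
  by apply/measurable_EFinP; exact: measurable_funX.
have := @ge0_integral_pushforward _ _ _ _ _ _ mfst muh setT _ measurableT mf2.
rewrite preimage_setT => <-; last by move=> x _; rewrite lee_fin sqr_ge0.
rewrite integral_fst nrm2 /ip /Rintegral fineK.
  by rewrite le_eqVlt; apply/orP; left; apply/eqP/eq_integral => x _; rewrite expr2.
by apply: integrable_fin_num => //; exact: L2_mul_integrable.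
Qed.

Lemma ip_fst f g : L2 mu f -> L2 mu g ->
  ip muh (f \o fst) (g \o fst) = ip mu f g.
Proof.
move=> Lf Lg; rewrite /ip /Rintegral; congr fine.
have mfg : measurable_fun setT (fun x => (f x * g x)%:E).
  apply/measurable_EFinP/measurable_funM;
    [exact: L2_measurable Lf|exact: L2_measurable Lg].
have := @integral_pushforward _ _ _ _ _ _ mfst muh setT _ mfg.
rewrite preimage_setT integral_fst => -> //.
exact: (L2_mul_integrable (L2_fst Lf) (L2_fst Lg)).
Qed.

Lemma nrm_fst f : L2 mu f -> nrm muh (f \o fst) = nrm mu f.
Proof. by move=> Lf; rewrite /nrm ip_fst. Qed.

Lemma L20_fst f : L20 mu f -> L20 muh (f \o fst).
Proof.
move=> [Lf f0]; split; first exact: L2_fst.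
by rewrite L2_mean_ip -[RHS]f0 (L2_mean_ip mu f); exact: (ip_fst Lf (L2_cst mu 1)).
Qed.

Variables (P : R -> (X -> R) -> (X -> R)).
Variables (Ph : R -> (X * V -> R) -> (X * V -> R)).
Hypothesis mP : markov_semigroup mu P.
Hypothesis mPh : markov_semigroup muh Ph.
Hypothesis lift : second_order_lift mu P muh Ph.

Lemma lift_poincare (K : R) : 0 < K ->
  (forall F G, is_generator muh Ph F G -> L20 muh F -> nrm muh F <= K * nrm muh G) ->
  forall f g, is_generator mu P f g -> L20 mu f ->
    (2 * K ^+ 2)^-1 * nrm mu f ^+ 2 <= - ip mu f g.
Proof.
move=> K0 bound f g fg Lf.
have [lift1 lift2] := lift.
have Df : Dom mu P f by exists g.
have [G fG] := lift1 _ Df.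
have [gen1 _] := is_generator_gen mPh.1 fG.
have [_ LG _] := (is_generatorP mPh.1 _ _).1 gen1.
have [gen2 e2] := is_generator_gen mP.1 fg.
have [_ Lg _] := (is_generatorP mP.1 _ _).1 fg.
have [_ Lg' _] := (is_generatorP mP.1 _ _).1 gen2.
have [_] := lift2 f f Df Df.
rewrite -[X in 2^-1 * X]/(ip muh (gen muh Ph (f \o fst)) (gen muh Ph (f \o fst))).
rewrite -nrm2 /dirichlet_form -[X in - X]/(ip mu f (gen mu P f)).
(* The Dirichlet form is built on the representative [gen mu P f], which is exchanged here for the
   given g. *)
rewrite (ae_eq_ip Lf.1 Lf.1 Lg' Lg _ (nrm_ae_eq Lg' Lg e2)); last exact: ae_eq_refl.
move=> <-; have := bound _ _ gen1 (L20_fst Lf); rewrite (nrm_fst Lf.1).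
rewrite -(@ler_pXn2r _ 2) ?nnegrE ?nrm_ge0 ?mulr_ge0 ?nrm_ge0 ?(ltW K0)//.
rewrite exprMn => b.
rewrite mulrC ler_pdivrMr ?mulr_gt0 ?exprn_gt0//.
lra.
Qed.

End lift.

(** * Relaxation times as delayed contraction *)

Section relaxation.
Context (d : measure_display) (T : measurableType d) (R : realType).
Variables (mu : probability T R) (Q : R -> (T -> R) -> (T -> R)).
Hypothesis mQ : markov_semigroup mu Q.
Let cQ : contraction_semigroup mu Q := mQ.1.

(** Iterating floor (s / t) times gives exp (- floor (s / t)) <= exp (1 - s / t): the loss from
    rounding down is exactly a delay t at rate 1 / t. *)
Lemma relaxation_delayed (t : R) : 0 < t ->
  (forall f, L20 mu f -> nrm mu (Q t f) <= expR (- 1) * nrm mu f) ->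
  delayed_contractive mu Q t t^-1.
Proof.
move=> t0 Ht f Lf s s0; have t0' := ltW t0.
have iter k g : L20 mu g -> nrm mu (Q (k%:R * t) g) <= expR (- k%:R) * nrm mu g.
  elim: k g => [|k IH] g Lg.
    by rewrite mul0r oppr0 expR0 mul1r; apply: (semigroup_nrm_le cQ) => //; exact: Lg.1.
  have kt0 : 0 <= k%:R * t by rewrite mulr_ge0.
  have Lt := markov_L20 mQ t0' Lg.
  have -> : k.+1%:R * t = k%:R * t + t by rewrite -natr1; ring.
  rewrite (nrm_eq_trans _ _ (semigroup_nrm_add cQ kt0 t0' Lg.1)); last 2 first.
  - by apply: (semigroup_L2 cQ); [exact: addr_ge0|exact: Lg.1].
  - by apply: (semigroup_L2 cQ) => //; exact: Lt.1.
  apply: le_trans (IH _ Lt) _.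
  have -> : - k.+1%:R = - k%:R + - 1 :> R by rewrite -natr1 opprD.
  by rewrite expRD -mulrA ler_wpM2l ?expR_ge0//; exact: Ht.
rewrite !L2normE; last 2 first.
- exact: Lf.1.
- by apply: (semigroup_L2 cQ) => //; exact: Lf.1.
rewrite -EFinM lee_fin; pose k := Num.truncn (s / t).
have /andP[ks sk] := truncn_itv (divr_ge0 s0 t0').
rewrite -/k ler_pdivlMr// in ks.
have kt0 : 0 <= k%:R * t by rewrite mulr_ge0.
apply: le_trans (semigroup_nrm_homo mQ kt0 ks Lf.1) _.
apply: le_trans (iter k f Lf) _; rewrite ler_wpM2r ?nrm_ge0// ler_expR.
have -> : - t^-1 * (s - t) = - (s / t) + 1 by field; rewrite gt_eqF.
by rewrite -/k -natr1 in sk; lra.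
Qed.

End relaxation.

Theorem theorem11 (R : realType) (d d' : measure_display)
    (X : measurableType d) (V : measurableType d')
    (mu : probability X R) (kappa : R.-pker X ~> V)
    (muh : probability (X * V)%type R)
    (P : R -> (X -> R) -> (X -> R))
    (Ph : R -> (X * V -> R) -> (X * V -> R)) :
  disintegrates muh mu kappa ->
  markov_semigroup mu P ->
  reversible mu P ->
  markov_semigroup muh Ph ->
  second_order_lift mu P muh Ph ->
  (forall T nu : R, 0 < T -> 0 < nu ->
     delayed_contractive muh Ph T nu \/ average_contractive muh Ph (2 * T) nu ->
     ((sqrte (2%:E * gap mu P))^-1 <= (nu^-1 + T)%:E)%E) /\
  (((2 * Num.sqrt 2)^-1)%:E * sqrte (relaxation_time mu P)
     <= relaxation_time muh Ph)%E.
Proof.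
move=> disint mP _ mPh lift; split=> [T nu T0 nu0 contr|].
  set K := nu^-1 + T.
  have K0 : 0 < K by rewrite addr_gt0// invr_gt0.
  have bound F G : is_generator muh Ph F G -> L20 muh F -> nrm muh F <= K * nrm muh G.
    case: contr => contr FG LF; first exact: (delayed_generator_bound mPh T0 nu0 contr).
    exact: (average_generator_bound mPh T0 nu0 contr).
  have c0 : 0 < (2 * K ^+ 2)^-1 by rewrite invr_gt0 mulr_gt0// exprn_gt0.
  have gapK := poincare_gap mP c0 (lift_poincare disint mP mPh lift K0 bound).
  (* With c = 1 / (2 K^2) the quantity sqrt (2 c) is exactly 1 / K, so the bound c <= gap has the
     desired form before inversion. *)
  have KE : (K^-1)%:E = sqrte (2%:E * ((2 * K ^+ 2)^-1)%:E).
    rewrite -EFinM /= invfM mulrA mulfV// mul1r -exprVn sqrtr_sqr ger0_norm//.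
    by rewrite invr_ge0 ltW.
  have le1 : ((K^-1)%:E <= sqrte (2%:E * gap mu P))%E.
    rewrite KE lee_sqrt ?lee_wpmul2l//.
    rewrite mule_ge0// (le_trans _ gapK)// lee_fin ltW//.
  (* The inversion takes place in the extended reals, so that an infinite gap is covered as well. *)
  have -> : K%:E = ((K^-1)%:E)^-1%E by rewrite inver invr_eq0 gt_eqF// invrK.
  rewrite lee_pV2// inE ?lee_fin ?invr_ge0 ?(ltW K0)//.
  exact: sqrte_ge0.
apply: le_ereal_inf_tmp => _ [t [t0 Ht] <-].
(* The time t = 0 may belong to the set defining the infimum, while the rate 1 / t requires a
   positive time; t + e inherits the contraction because norms decrease along the semigroup. *)
apply/lee_addgt0Pr => e e0.
set s := t + e; have s0 : 0 < s by rewrite ltr_wpDl.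
have Hs f : L20 muh f -> nrm muh (Ph s f) <= expR (- 1) * nrm muh f.
  move=> Lf; apply: le_trans (_ : nrm muh (Ph t f) <= _).
    by apply: (semigroup_nrm_homo mPh) => //; [rewrite lerDl ltW|exact: Lf.1].
  have := Ht f Lf; rewrite (L2normE Lf.1) (L2normE (semigroup_L2 mPh.1 t0 Lf.1)).
  by rewrite -EFinM lee_fin.
have si0 : 0 < s^-1 by rewrite invr_gt0.
have dl := relaxation_delayed mPh s0 Hs.
have bound F G : is_generator muh Ph F G -> L20 muh F -> nrm muh F <= (2 * s) * nrm muh G.
  move=> FG LF; have := delayed_generator_bound mPh s0 si0 dl FG LF.
  by rewrite invrK mulrDl; lra.
have s20 : 0 < 2 * s by exact: mulr_gt0.
have c0 : 0 < (2 * (2 * s) ^+ 2)^-1 by rewrite invr_gt0 mulr_gt0// exprn_gt0.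
have := relaxation_time_le mP c0 (lift_poincare disint mP mPh lift s20 bound).
rewrite invrK => le1.
have c2 : 0 < 2 * Num.sqrt 2 :> R by rewrite mulr_gt0// sqrtr_gt0.
have r0 : 0 <= 2 * (2 * s) ^+ 2 by rewrite mulr_ge0// sqr_ge0.
(* The square root of 2 (2 s)^2 is 2 sqrt 2 times s, which the constant 1 / (2 sqrt 2) cancels
   exactly. *)
apply: le_trans (_ : ((2 * Num.sqrt 2)^-1)%:E * sqrte (2 * (2 * s) ^+ 2)%:E <= _)%E.
  by apply: lee_wpmul2l; [rewrite lee_fin invr_ge0 ltW|rewrite lee_sqrt].
rewrite -EFinD -/s -[sqrte _]/((Num.sqrt (2 * (2 * s) ^+ 2))%:E) -EFinM lee_fin sqrtrM// sqrtr_sqr gtr0_norm//.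
rewrite le_eqVlt; apply/orP; left; apply/eqP; field.
by rewrite gt_eqF// sqrtr_gt0.
Qed.
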